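(* Let $\mu$ be a nonzero bounded positive Borel measure on $\mathbb{R}$. Then $P^d_\lambda<\infty$ for every $\lambda>0$. If in addition $\mu$ has bounded support, then for every $\lambda>0$ there exists $f\in l^2(\mathbb{Z})$ with $\|f\|_{l^2}^2=\lambda$ and $\mathcal{Q}^d_\mu(f,f,f,f)=P^d_\lambda$, and any such maximizer satisfies, with $\omega=P^d_\lambda/\lambda>0$, $$\omega\langle g,f\rangle=\mathcal{Q}^d_\mu(g,f,f,f)\quad\text{for all } g\in l^2(\mathbb{Z}).$$
   Context: Let $\Delta$ be the discrete Laplacian on $l^2(\mathbb{Z})$, $(\Delta f)(x)=f(x+1)+f(x-1)-2f(x)$, and $S_r=e^{ir\Delta}$ ($r\in\mathbb{R}$). For a positive Borel measure $\mu$ on $\mathbb{R}$ and $f_1,\dots,f_4\in l^2(\mathbb{Z})$ define $$\mathcal{Q}^d_\mu(f_1,f_2,f_3,f_4)=\sum_{x\in\mathbb{Z}}\int_{\mathbb{R}}\overline{(S_rf_1)(x)}\,(S_rf_2)(x)\,\overline{(S_rf_3)(x)}\,(S_rf_4)(x)\,\mu(dr),$$ and $P^d_\lambda=\sup\{\mathcal{Q}^d_\mu(f,f,f,f): f\in l^2(\mathbb{Z}),\ \|f\|_{l^2}^2=\lambda\}$. The inner product is $\langle g,f\rangle=\sum_x\overline{g(x)}f(x)$. *)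

(* Defs.v *)
From HB Require Import structures.
From mathcomp Require Import all_boot all_order all_algebra.
From mathcomp Require Import all_classical all_reals all_analysis.
From mathcomp Require Import complex.

Set Implicit Arguments.
Unset Strict Implicit.
Unset Printing Implicit Defensive.

Import Order.TTheory GRing.Theory Num.Theory.
Import numFieldTopology.Exports numFieldNormedType.Exports.
Local Open Scope classical_set_scope.
Local Open Scope ring_scope.
Local Open Scope complex_scope.

(** topology / metric structure on the complex numbers R[i], inherited
    from its canonical numClosedFieldType structure *)
HB.instance Definition _ (R : realType) :=
  PseudoPointedMetric.copy R[i] (R[i])^o.

Section Defs.
Variable R : realType.
Local Notation C := R[i].

Definition l2sqnorm (f : int -> C) : \bar R :=
  (\esum_(x in [set: int]) ((complex.Re (f x)) ^+ 2 + (complex.Im (f x)) ^+ 2)%:E)%E.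

Definition is_l2 (f : int -> C) : Prop := (l2sqnorm f < +oo)%E.

Definition sumZ (a : int -> C) : C :=
  lim ((fun N : nat => \sum_(k < (N + N).+1) a (k%:Z - N%:Z)) @ \oo).

Definition inner (g f : int -> C) : C := sumZ (fun x => (g x)^* * f x).

Definition dlap (f : int -> C) : int -> C :=
  fun x => f (x + 1) + f (x - 1) - 2%:R * f x.

(** S_r = e^{i r Delta}, via the exponential series (Delta is bounded) *)
Definition Sr (r : R) (f : int -> C) : int -> C :=
  fun x => lim ((fun N : nat =>
     \sum_(n < N) ((('i * r%:C) ^+ n) / (n`!)%:R * iter n dlap f x)) @ \oo).

Definition Cintegral (mu : {measure set R -> \bar R}) (h : R -> C) : C :=
  (Rintegral mu [set: R] (fun r => complex.Re (h r))) +i*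
  (Rintegral mu [set: R] (fun r => complex.Im (h r))).

Definition Qd (mu : {measure set R -> \bar R}) (f1 f2 f3 f4 : int -> C) : C :=
  sumZ (fun x => Cintegral mu (fun r =>
     (Sr r f1 x)^* * Sr r f2 x * (Sr r f3 x)^* * Sr r f4 x)).

Definition Pd (mu : {measure set R -> \bar R}) (lam : R) : \bar R :=
  ereal_sup [set (complex.Re (Qd mu f f f f))%:E | f in
     [set f | is_l2 f /\ l2sqnorm f = lam%:E]].

End Defs.

(* Main.v *)
Require Import Defs.
From HB Require Import structures.
From mathcomp Require Import all_boot all_order all_algebra.
From mathcomp Require Import all_classical all_reals all_analysis.
From mathcomp Require Import complex.
From mathcomp Require Import measurable_realfun.
From mathcomp Require Import ring lra zify.
Import Order.TTheory GRing.Theory Num.Theory.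
Import numFieldNormedType.Exports.
Local Open Scope classical_set_scope.
Local Open Scope ring_scope.
Local Open Scope complex_scope.

(** Write [q f] for [Qd mu f f f f], [P] for the supremum at mass [lam] and [c = P / lam^2], so
    that [q h <= c |h|^4] for all [h] by homogeneity.

    Finiteness: [S_r] does not increase the l^2 norm, because it is the limit of
    the Euler scheme [(1 + (i r / n) Delta)^n] and one Euler step changes the
    squared norm only by a factor [1 + O(r^2 / n^2)].

    Existence: if [mu] lives on [[-M, M]], then [|S_r f| <= e^(4M) sup |f|], so a
    maximizing sequence cannot flatten out and, after translations, has a nonzero
    pointwise limit [f] along an ultrafilter.  With [g_n = f_n - f] -> 0 pointwise,
    both [|f_n|^2] and [q f_n] split asymptotically (Brezis-Lieb), whence
    [lam^2 <= a^2 + (lam - a)^2] for [a = |f|^2 > 0].  This forces [a = lam], so no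
    mass is lost and [f] is a maximizer.

    Euler-Lagrange equation: by convexity of [|z|^4],
    [q f + 4 t Re Qd g f f f <= q (f + t g) <= c |f + t g|^4] for every real [t],
    with equality at [t = 0], so the first-order terms agree; [i g] in place
    of [g] gives the imaginary part. *)

(** * Window sums in an abelian group *)

Set Implicit Arguments.
Unset Strict Implicit.
Unset Printing Implicit Defensive.

(** The partial sum appearing in [sumZ], so that [sumZ a] unfolds to the limit of [win a]; the
    general [V] serves both real and complex summands. *)
Definition win (V : zmodType) (a : int -> V) (N : nat) : V :=
  \sum_(k < (N + N).+1) a (k%:Z - N%:Z).

Lemma win0 (V : zmodType) (a : int -> V) : win a 0 = a 0.
Proof. by rewrite /win big_ord1. Qed.

Lemma winS (V : zmodType) (a : int -> V) N :
  win a N.+1 = win a N + a N.+1%:Z + a (- N.+1%:Z).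
Proof.
rewrite /win addSn addnS big_ord_recl big_ord_recr /= [LHS]addrC.
congr (_ + _ + _); [|by congr a; rewrite /bump /=; lia..].
by apply: eq_bigr => i _; congr a; rewrite /bump /=; lia.
Qed.

Lemma eq_win (V : zmodType) (a b : int -> V) N : a =1 b -> win a N = win b N.
Proof. by move=> e; apply: eq_bigr => i _; rewrite e. Qed.

Lemma winN (V : zmodType) (a : int -> V) N : win (fun x => a (- x)) N = win a N.
Proof.
by elim: N => [|N IH]; rewrite ?win0 ?oppr0 // !winS IH opprK addrAC.
Qed.

(** The shifted window gains one site on the right and loses its leftmost one; this is what makes
    discrete divergences telescope. *)
Lemma win_shift (V : zmodType) (a : int -> V) N :
  win (fun x => a (x + 1)) N = win a N + a N.+1%:Z - a (- N%:Z).
Proof.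
elim: N => [|N IH]; first by rewrite !win0 oppr0 add0r addrAC subrr add0r.
rewrite !winS IH.
have -> : - (N.+1%:Z) + 1 = - N%:Z :> int by lia.
have -> : N.+1%:Z + 1 = N.+2%:Z :> int by lia.
by rewrite addrAC subrK -[RHS]addrA [_ + - _]addrC addrA addrK.
Qed.

Lemma winD (V : zmodType) (a b : int -> V) N :
  win (fun x => a x + b x) N = win a N + win b N.
Proof. by rewrite /win big_split. Qed.

(** * Symmetric partial sums over the integers *)

Section RealWindows.
Variable R : realType.
Implicit Types (a b c : int -> R).

Lemma winZ (k : R) a N : win (fun x => k * a x) N = k * win a N.
Proof. by rewrite /win mulr_sumr. Qed.

Lemma win_ge0 a N : (forall x, 0 <= a x) -> 0 <= win a N.
Proof. by move=> a0; apply: sumr_ge0. Qed.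

Lemma ler_win a b N : (forall x, a x <= b x) -> win a N <= win b N.
Proof. by move=> ab; apply: ler_sum. Qed.

Lemma ler_norm_win a N : `|win a N| <= win (fun x => `|a x|) N.
Proof. exact: ler_norm_sum. Qed.

Lemma ler_win_diff a b N N' : (forall x, a x <= b x) -> (N <= N')%N ->
  win a N' - win a N <= win b N' - win b N.
Proof.
move=> ab /subnK <-; elim: (N' - N)%N => [|k IH]; first by rewrite add0n !subrr.
rewrite addSn !winS; have := ab (k + N).+1%:Z; have := ab (- (k + N).+1%:Z).
lra.
Qed.

Lemma nondecreasing_win a N N' : (forall x, 0 <= a x) -> (N <= N')%N ->
  win a N <= win a N'.
Proof.
move=> a0 NN; have := ler_win_diff a0 NN.
by rewrite /win !big1_eq subrr subr_ge0.
Qed.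

Lemma ler_term_win a x N : (forall y, 0 <= a y) -> (`|x| <= N)%N ->
  a x <= win a N.
Proof.
move=> a0; elim: N => [|N IH] xN.
  by rewrite win0; have -> : x = 0 by lia.
rewrite winS; have := a0 N.+1%:Z; have := a0 (- N.+1%:Z).
have := win_ge0 N a0.
have [/IH|] := leqP `|x| N; first lra.
move=> Nx; have [->|->] : x = N.+1%:Z \/ x = - N.+1%:Z by lia.
- lra.
- lra.
Qed.

(** For nonnegative [a] this is summability with total at most [A]. Applied to squared moduli, it is
    the quantitative form of membership in l^2 used throughout. *)
Definition bnd a (A : R) := forall N, win a N <= A.

Lemma bnd_ge0 a A : (forall x, 0 <= a x) -> bnd a A -> 0 <= A.
Proof. by move=> a0 aA; apply: le_trans (aA 0); exact: win_ge0. Qed.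

Lemma bnd_term a A x : (forall y, 0 <= a y) -> bnd a A -> a x <= A.
Proof. by move=> a0 aA; apply: le_trans (aA `|x|%N); exact: ler_term_win. Qed.

Lemma bnd_shift1 a A : (forall x, 0 <= a x) -> bnd a A ->
  bnd (fun x => a (x + 1)) A.
Proof.
move=> a0 aA N; rewrite win_shift; apply: le_trans (aA N.+1); rewrite winS.
by have := a0 (- N%:Z); have := a0 (- N.+1%:Z); lra.
Qed.

Lemma bnd_opp a A : bnd a A -> bnd (fun x => a (- x)) A.
Proof. by move=> aA N; rewrite winN. Qed.

Lemma bnd_shiftn a A (n : nat) : (forall x, 0 <= a x) -> bnd a A ->
  bnd (fun x => a (x + n%:Z)) A.
Proof.
move=> a0 aA; elim: n => [|n IH].
  by move=> N; rewrite (eq_win _ (b := a)) // => x; rewrite addr0.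
move=> N; rewrite (eq_win _ (b := fun x => a (x + 1 + n%:Z))); last first.
  by move=> x; congr a; lia.
exact: (@bnd_shift1 (fun x => a (x + n%:Z))).
Qed.

Lemma bnd_shift a A (z : int) : (forall x, 0 <= a x) -> bnd a A ->
  bnd (fun x => a (x + z)) A.
Proof.
move=> a0 aA; have [n [->|->]] : exists n : nat, z = n%:Z \/ z = - n%:Z.
  by exists `|z|%N; lia.
  exact: bnd_shiftn.
(* Reflection turns a negative shift into a positive one. *)
move=> N; rewrite -winN.
rewrite (eq_win _ (b := fun x => a (- (x + n%:Z)))); last first.
  by move=> x; congr a; lia.
exact: (@bnd_shiftn (fun x => a (- x)) A n (fun=> a0 _) (bnd_opp aA)).
Qed.

Definition sm a : R := limn (win a).

Lemma cvg_bnd a A : (forall x, 0 <= a x) -> bnd a A -> cvgn (win a).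
Proof.
move=> a0 aA; apply: nondecreasing_is_cvgn.
  by move=> m n; exact: nondecreasing_win.
by exists A => _ [n _ <-].
Qed.

Lemma win_le_sm a A N : (forall x, 0 <= a x) -> bnd a A -> win a N <= sm a.
Proof.
move=> a0 aA; apply: nondecreasing_cvgn_le; last exact: cvg_bnd aA.
by move=> m n; exact: nondecreasing_win.
Qed.

Lemma bnd_sm a A : (forall x, 0 <= a x) -> bnd a A -> bnd a (sm a).
Proof. by move=> a0 aA N; exact: win_le_sm aA. Qed.

Lemma sm_le a A : (forall x, 0 <= a x) -> bnd a A -> sm a <= A.
Proof.
move=> a0 aA; apply: limr_le; first exact: cvg_bnd aA.
by apply: nearW.
Qed.

Lemma sm_shift a A z : (forall x, 0 <= a x) -> bnd a A ->
  sm (fun x => a (x + z)) = sm a.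
Proof.
move=> a0 aA; apply/eqP; rewrite eq_le; apply/andP; split.
  by apply: sm_le => //; apply: bnd_shift => //; exact: bnd_sm aA.
have aAz := bnd_shift z a0 aA.
(* The reverse inequality comes from shifting back by [- z]. *)
apply: sm_le => // N.
rewrite (eq_win _ (b := fun x => a (x + - z + z))); last by move=> x; rewrite subrK.
by apply: (@bnd_shift (fun x => a (x + z)) _ (- z)) => //; exact: bnd_sm aAz.
Qed.

Lemma smZ (k : R) a A : (forall x, 0 <= a x) -> bnd a A ->
  sm (fun x => k * a x) = k * sm a.
Proof.
move=> a0 aA; apply: cvg_lim; first exact: Rhausdorff.
have -> : win (fun x => k * a x) = (fun N => k * win a N).
  by apply/funext => N; exact: winZ.
by apply: cvgMl_tmp; exact: cvg_bnd aA.
Qed.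

Lemma cvg_abs_bnd a A : bnd (fun x => `|a x|) A -> cvgn (win a).
Proof.
move=> aA.
(* Write [a] as the difference of the nonnegative sequences [a + |a|] and [|a|], both with bounded
   windows. *)
have h : cvgn (win (fun x => a x + `|a x|)).
  apply: (@cvg_bnd _ (A + A)) => [x|N].
    by have := ler_norm (- a x); rewrite normrN; lra.
  rewrite winD lerD //; apply: le_trans (aA N); apply: ler_win => x; exact: ler_norm.
have h2 : cvgn (win (fun x => `|a x|)) by apply: cvg_bnd aA => x; exact: normr_ge0.
have -> : win a = win (fun x => a x + `|a x|) \- win (fun x => `|a x|).
  by apply/funext => N /=; rewrite winD addrK.
exact: is_cvgB.
Qed.

Lemma win_tail a A e : (forall x, 0 <= a x) -> bnd a A -> 0 < e ->
  exists L, forall N, (L <= N)%N -> win a N - win a L <= e.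
Proof.
move=> a0 aA e0; have /cvgrPdist_le /(_ e e0) [L _ h] := cvg_bnd a0 aA.
exists L => N LN; have := h L (leqnn L) => /=.
have := win_le_sm N a0 aA; have := win_le_sm L a0 aA; rewrite -/(sm a).
by move=> h1 h2 h3; have := ler_norm (sm a - win a L); lra.
Qed.

Lemma bnd_cvg0 a A : (forall x, 0 <= a x) -> bnd a A ->
  (fun n : nat => a n%:Z) @ \oo --> 0.
Proof.
move=> a0 aA; apply/cvgrPdist_le => e e0.
have [L hL] := win_tail a0 aA e0.
exists L.+1 => // -[//|n] /= Ln; rewrite sub0r normrN ger0_norm //.
have := hL n.+1 (ltnW Ln); rewrite winS.
have := nondecreasing_win a0 (Ln : (L <= n)%N); have := a0 (- n.+1%:Z); lra.
Qed.

(** * The l^2 norm as a limit of window sums *)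

Definition sqc (z : R[i]) : R := complex.Re z ^+ 2 + complex.Im z ^+ 2.

Lemma sqc_ge0 z : 0 <= sqc z.
Proof. by rewrite addr_ge0 // sqr_ge0. Qed.

(** Listing the sites of a window allows comparison with the arbitrary finite sets that enter
    [esum]. *)
Definition wseq N := [seq k%:Z - N%:Z | k <- iota 0 (N + N).+1].

Lemma winE (V : zmodType) (a : int -> V) N : win a N = \sum_(x <- wseq N) a x.
Proof. by rewrite /win big_map -[iota 0 _]/(index_iota 0 (N + N).+1) big_mkord. Qed.

Lemma wseq_uniq N : uniq (wseq N).
Proof. by rewrite map_inj_uniq ?iota_uniq // => x y; lia. Qed.

Lemma subset_wseq (s : seq int) : exists N, {subset s <= wseq N}.
Proof.
exists (\sum_(x <- s) `|x|%N)%N => x xs.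
have xN : (`|x| <= \sum_(x <- s) `|x|%N)%N by rewrite (big_rem x) //= leq_addr.
move: (\sum_(x <- s) `|x|%N)%N xN => N xN.
apply/mapP; exists (absz (x + N%:Z)); last by lia.
by rewrite mem_iota; lia.
Qed.

Lemma win_le_l2sqnorm (f : int -> R[i]) N :
  ((win (sqc \o f) N)%:E <= l2sqnorm f)%E.
Proof.
apply: esum_ge; exists [set` wseq N]; first by split => //; exact: finite_seq.
by rewrite -fsbig_seq ?wseq_uniq // winE -sumEFin.
Qed.

(** The terms are nonnegative, so it suffices that every finite set lies in some window and that
    every window is itself a finite set. *)
Lemma l2sqnorm_sm (f : int -> R[i]) A : bnd (sqc \o f) A ->
  l2sqnorm f = (sm (sqc \o f))%:E.
Proof.
move=> aA; have a0 x : 0 <= (sqc \o f) x by exact: sqc_ge0.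
apply/eqP; rewrite eq_le; apply/andP; split.
  apply: ge_ereal_sup => _ [B [fB _] <-].
  rewrite fsbig_finite //=.
  have [N hN] := subset_wseq (finmap.enum_fset (fset_set B)).
  rewrite sumEFin lee_fin; apply: le_trans (win_le_sm N a0 aA); rewrite winE.
  rewrite [leRHS](bigID (mem (finmap.enum_fset (fset_set B)))) -big_filter.
  rewrite [X in _ <= X + _](perm_big (finmap.enum_fset (fset_set B))); last first.
    apply: uniq_perm; rewrite ?filter_uniq ?finmap.fset_uniq ?wseq_uniq // => x.
    by rewrite mem_filter /=; case: (boolP (x \in _)) => // /hN ->.
  by rewrite lerDl sumr_ge0.
have <- : limn (EFin \o win (sqc \o f)) = (sm (sqc \o f))%:E.
  by rewrite EFin_lim //; exact: cvg_bnd aA.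
apply: lime_le.
  by apply/cvg_ex; exists (sm (sqc \o f))%:E; apply: cvg_EFin; [exact: nearW | exact: cvg_bnd aA].
by apply: nearW => N; exact: win_le_l2sqnorm.
Qed.

Lemma is_l2P (f : int -> R[i]) : is_l2 f <-> exists A, bnd (sqc \o f) A.
Proof.
split=> [|[A fA]]; last by rewrite /is_l2 (l2sqnorm_sm fA) ltry.
rewrite /is_l2 => fl; exists (fine (l2sqnorm f)) => N.
have h0 : (0 <= l2sqnorm f)%E by apply: esum_ge0 => x _; rewrite lee_fin sqc_ge0.
by rewrite -lee_fin fineK ?ge0_fin_numE //; exact: win_le_l2sqnorm.
Qed.
End RealWindows.

(** * Complex limits through real and imaginary parts *)

Section ComplexLimits.
Variable R : realType.
Local Notation C := R[i].
Local Notation Re := (@complex.Re R).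
Local Notation Im := (@complex.Im R).
Local Notation normc := (@ComplexField.Normc.normc R).
Implicit Types z w : C.

Lemma ReD z w : Re (z + w) = Re z + Re w. Proof. by case: z w => ? ? []. Qed.
Lemma ImD z w : Im (z + w) = Im z + Im w. Proof. by case: z w => ? ? []. Qed.
Lemma ReN z : Re (- z) = - Re z. Proof. by case: z. Qed.
Lemma ImN z : Im (- z) = - Im z. Proof. by case: z. Qed.
Lemma ReM z w : Re (z * w) = Re z * Re w - Im z * Im w.
Proof. by case: z w => ? ? []. Qed.
Lemma ImM z w : Im (z * w) = Re z * Im w + Im z * Re w.
Proof. by case: z w => ? ? []. Qed.
Lemma ReJ z : Re z^* = Re z. Proof. by case: z. Qed.
Lemma ImJ z : Im z^* = - Im z. Proof. by case: z. Qed.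
Lemma Re_nat n : Re (n%:R : C) = n%:R.
Proof. by elim: n => // n IH; rewrite -addn1 !natrD ReD IH. Qed.
Lemma Im_nat n : Im (n%:R : C) = 0.
Proof. by elim: n => // n IH; rewrite -addn1 !natrD ImD IH addr0. Qed.
Definition reimE := (ReD, ImD, ReN, ImN, ReM, ImM, ReJ, ImJ, Re_nat, Im_nat).

Lemma eqC z w : Re z = Re w -> Im z = Im w -> z = w.
Proof. by case: z w => ? ? [? ?] /= -> ->. Qed.

Lemma Re_sum (I : Type) (s : seq I) (u : I -> C) :
  Re (\sum_(i <- s) u i) = \sum_(i <- s) Re (u i).
Proof. by elim/big_ind2: _ => // z a w b <- <-; rewrite ReD. Qed.

Lemma Im_sum (I : Type) (s : seq I) (u : I -> C) :
  Im (\sum_(i <- s) u i) = \sum_(i <- s) Im (u i).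
Proof. by elim/big_ind2: _ => // z a w b <- <-; rewrite ImD. Qed.

Lemma Re_win (a : int -> C) N : Re (win a N) = win (fun x => Re (a x)) N.
Proof. by rewrite /win Re_sum. Qed.

Lemma Im_win (a : int -> C) N : Im (win a N) = win (fun x => Im (a x)) N.
Proof. by rewrite /win Im_sum. Qed.

Lemma sqcM z w : sqc (z * w) = sqc z * sqc w.
Proof. by rewrite /sqc !reimE; ring. Qed.

Lemma normc_sqrt z : normc z = Num.sqrt (sqc z). Proof. by case: z. Qed.

Lemma normc_ge0 z : 0 <= normc z. Proof. by rewrite normc_sqrt sqrtr_ge0. Qed.

Lemma sqr_normc z : normc z ^+ 2 = sqc z.
Proof. by rewrite normc_sqrt sqr_sqrtr ?sqc_ge0. Qed.

Lemma normc_le z a : 0 <= a -> sqc z <= a ^+ 2 -> normc z <= a.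
Proof. by move=> a0 h; rewrite -ler_sqr ?nnegrE ?normc_ge0 // sqr_normc. Qed.

Lemma ler_normcD z w : normc (z + w) <= normc z + normc w.
Proof. exact: le_normcD. Qed.

Lemma normc_opp z : normc (- z) = normc z. Proof. exact: normcN. Qed.

Lemma ler_normc_sum (I : Type) (s : seq I) (u : I -> C) :
  normc (\sum_(i <- s) u i) <= \sum_(i <- s) normc (u i).
Proof.
elim/big_rec2: _ => [|i a z _ h]; first by rewrite ComplexField.Normc.normc0.
by apply: le_trans (ler_normcD _ _) _; rewrite lerD2l.
Qed.

Lemma Re_le_normc z : `|Re z| <= normc z.
Proof.
rewrite -ler_sqr ?nnegrE ?normc_ge0 // sqr_normc real_normK ?num_real //.
by rewrite /sqc lerDl sqr_ge0.
Qed.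

Lemma Im_le_normc z : `|Im z| <= normc z.
Proof.
rewrite -ler_sqr ?nnegrE ?normc_ge0 // sqr_normc real_normK ?num_real //.
by rewrite /sqc lerDr sqr_ge0.
Qed.

(** The filter is arbitrary because limits are taken both along [\oo] and along an ultrafilter on
    the indices. *)
Definition ccvg (T : Type) (F : set_system T) (u : T -> C) (l : C) :=
  (Re (u n) @[n --> F] --> Re l) /\ (Im (u n) @[n --> F] --> Im l).

Section Ccvg.
Variables (T : Type) (F : set_system T).
Context {FF : ProperFilter F}.
Implicit Types u v : T -> C.

Lemma ccvg_cst z : ccvg F (fun=> z) z.
Proof. by split; exact: cvg_cst. Qed.

Lemma ccvgD u v l m : ccvg F u l -> ccvg F v m ->
  ccvg F (fun n => u n + v n) (l + m).
Proof.
move=> [a b] [c d]; split; rewrite ?reimE.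
  by under eq_fun do rewrite ReD; exact: cvgD.
by under eq_fun do rewrite ImD; exact: cvgD.
Qed.

Lemma ccvgM u v l m : ccvg F u l -> ccvg F v m ->
  ccvg F (fun n => u n * v n) (l * m).
Proof.
move=> [a b] [c d]; split; rewrite ?reimE.
  by under eq_fun do rewrite ReM; apply: cvgB; exact: cvgM.
by under eq_fun do rewrite ImM; apply: cvgD; exact: cvgM.
Qed.

Lemma ccvgN u l : ccvg F u l -> ccvg F (fun n => - u n) (- l).
Proof.
move=> [a b]; split; rewrite ?reimE.
  by under eq_fun do rewrite ReN; exact: cvgN.
by under eq_fun do rewrite ImN; exact: cvgN.
Qed.

Lemma ccvg_sqc u l : ccvg F u l -> sqc (u n) @[n --> F] --> sqc l.
Proof. by move=> [a b]; apply: cvgD; rewrite expr2; apply: cvgM. Qed.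

Lemma ccvg_normc_le u l A : ccvg F u l -> (\forall n \near F, normc (u n) <= A) ->
  normc l <= A.
Proof.
move=> ul uA; have A0 : 0 <= A.
  by have [n] := @filter_ex _ F _ _ uA; apply: le_trans; exact: normc_ge0.
apply: normc_le => //; have h := ccvg_sqc ul.
rewrite -(cvg_lim (@Rhausdorff _) h); apply: limr_le.
  by apply/cvg_ex; exists (sqc l).
by apply: filterS uA => n un; rewrite -sqr_normc ler_sqr ?nnegrE ?normc_ge0.
Qed.

End Ccvg.

(** The bridge to the topological [lim] occurring in [Sr] and [sumZ]: the modulus is at most the sum
    of the moduli of the real and imaginary parts. *)
Lemma ccvg_lim (u : nat -> C) l : ccvg \oo u l -> lim (u @ \oo) = l.
Proof.
move=> [a b]; apply: cvg_lim; first exact: (@norm_hausdorff C C^o).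
apply/(@cvgrPdist_lt C C^o) => e e0.
(* In the partial order on the complex numbers a positive element is real. *)
have [d d0 ed] : exists2 d : R, 0 < d & e = d%:C.
  by case: e e0 => x y; rewrite ltcE /= => /andP[/eqP -> x0]; exists x.
have d20 : 0 < d / 2 by lra.
move/cvgrPdist_lt : a => /(_ _ d20) a; move/cvgrPdist_lt : b => /(_ _ d20) b.
near=> n; rewrite ed.
have -> : `|l - u n| = (normc (l - u n))%:C by [].
rewrite ltcR; have -> : l - u n = (Re l - Re (u n))%:C + 'i * (Im l - Im (u n))%:C.
  by apply: eqC; rewrite !reimE /=; ring.
apply: le_lt_trans (ler_normcD _ _) _.
rewrite ComplexField.Normc.normcM !normc_sqrt /sqc /= !expr0n /= expr1n !addr0 add0r sqrtr1.
rewrite mul1r !sqrtr_sqr (_ : d = d / 2 + d / 2); last by lra.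
by apply: ltrD; near: n.
Unshelve. all: by end_near.
Qed.
End ComplexLimits.

(** * The series defining the propagator *)

Section Propagator.
Variable R : realType.
Local Notation C := R[i].
Local Notation Re := (@complex.Re R).
Local Notation Im := (@complex.Im R).
Local Notation normc := (@ComplexField.Normc.normc R).
Implicit Types (f g : int -> C) (r M : R).

Lemma ccvg_series (u : nat -> C) (v : R^nat) :
  (forall n, normc (u n) <= v n) -> cvgn (series v) ->
  ccvg \oo (fun N => \sum_(n < N) u n) (lim ((fun N => \sum_(n < N) u n) @ \oo)).
Proof.
move=> uv cv.
(* Here [p] stands for [Re] or [Im], and absolute convergence follows by comparison with [v]. *)
have main (p : C -> R) : (forall z, `|p z| <= normc z) -> cvgn (series (p \o u)).
  move=> hp; apply: normed_cvg; apply: (series_le_cvg _ _ _ cv) => n /=.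
  - exact: normr_ge0.
  - exact: le_trans (normc_ge0 _) (uv n).
  - exact: le_trans (hp _) (uv n).
suff h : ccvg \oo (fun N => \sum_(n < N) u n)
    (limn (series (Re \o u)) +i* limn (series (Im \o u))) by rewrite (ccvg_lim h).
split => /=.
  under eq_fun do rewrite Re_sum -(big_mkord xpredT (fun i => Re (u i))).
  exact: main (@Re_le_normc R).
under eq_fun do rewrite Im_sum -(big_mkord xpredT (fun i => Im (u i))).
exact: main (@Im_le_normc R).
Qed.

Definition SrN r f x N : C :=
  \sum_(n < N) ((('i * r%:C) ^+ n) / (n`!)%:R * iter n (@dlap R) f x).

Lemma normc_real (a : R) : normc a%:C = `|a|.
Proof. by rewrite normc_sqrt /sqc /= expr0n addr0 sqrtr_sqr. Qed.

Lemma normc_nat n : normc (n%:R) = n%:R.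
Proof. by rewrite normc_sqrt /sqc Re_nat Im_nat expr0n addr0 sqrtr_sqr ger0_norm. Qed.

Lemma normcX (z : C) n : normc (z ^+ n) = normc z ^+ n.
Proof.
elim: n => [|n IH]; first by rewrite !expr0 ComplexField.Normc.normc1.
by rewrite !exprS ComplexField.Normc.normcM IH.
Qed.

Lemma normc_i : normc ('i%C : C) = 1.
Proof. by rewrite normc_sqrt /sqc /= expr0n expr1n add0r sqrtr1. Qed.

(** The factor 4 is the sum 1 + 1 + 2 of the moduli of the coefficients; it is the source of the
    exponent [4 * M] below. *)
Lemma normc_dlap f B : (forall x, normc (f x) <= B) ->
  forall x, normc (dlap f x) <= 4 * B.
Proof.
move=> fB x; rewrite /dlap; apply: le_trans (ler_normcD _ _) _.
rewrite normc_opp ComplexField.Normc.normcM normc_nat.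
have := ler_normcD (f (x + 1)) (f (x - 1)).
have := fB (x + 1); have := fB (x - 1); have := fB x; lra.
Qed.

Lemma normc_iter_dlap f B n : (forall x, normc (f x) <= B) ->
  forall x, normc (iter n (@dlap R) f x) <= 4 ^+ n * B.
Proof.
move=> fB; elim: n => [|n IH] x; first by rewrite expr0 mul1r.
by rewrite iterS exprS -mulrA; exact: normc_dlap.
Qed.

Lemma normc_bound_ge0 f B : (forall x, normc (f x) <= B) -> 0 <= B.
Proof. by move=> fB; apply: le_trans (fB 0); exact: normc_ge0. Qed.

Lemma normc_SrN_term f B r M n x : (forall x, normc (f x) <= B) -> `|r| <= M ->
  normc ((('i * r%:C) ^+ n) / (n`!)%:R * iter n (@dlap R) f x) <=
  B * exp_coeff (4 * M) n.
Proof.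
move=> fB rM; rewrite !ComplexField.Normc.normcM ComplexField.Normc.normcV.
rewrite normc_nat normcX ComplexField.Normc.normcM normc_i mul1r normc_real.
rewrite /exp_coeff /= exprMn.
have -> : B * (4 ^+ n * M ^+ n / n`!%:R) = M ^+ n / n`!%:R * (4 ^+ n * B) by ring.
have h : `|r| ^+ n <= M ^+ n.
  by rewrite lerXn2r ?nnegrE ?normr_ge0 // (le_trans _ rM).
apply: ler_pM; rewrite ?normc_ge0 ?mulr_ge0 ?invr_ge0 ?exprn_ge0 //.
- by rewrite ler_wpM2r ?invr_ge0.
- exact: normc_iter_dlap.
Qed.

Lemma Sr_ccvg f B r x : (forall x, normc (f x) <= B) ->
  ccvg \oo (SrN r f x) (Sr r f x).
Proof.
move=> fB; have := @ccvg_series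
  (fun n => (('i * r%:C) ^+ n) / (n`!)%:R * iter n (@dlap R) f x)
  (fun n => B * exp_coeff (4 * `|r|) n).
apply; first by move=> n; exact: normc_SrN_term.
by apply: (@is_cvg_seriesZ _ (exp_coeff _)); exact: is_cvg_series_exp_coeff.
Qed.

(** The remainder of the exponential series, which bounds the truncation error of [Sr] uniformly in
    the site and in [|r| <= M]. *)
Definition etail (a : R) N : R := expR a - series (exp_coeff a) N.

Lemma cvg_etail a : etail a @ \oo --> 0.
Proof.
rewrite -(subrr (expR a)); apply: cvgB; first exact: cvg_cst.
exact: is_cvg_series_exp_coeff.
Qed.

Lemma Sr_tail f B r M x N : (forall x, normc (f x) <= B) -> `|r| <= M ->
  normc (Sr r f x - SrN r f x N) <= B * etail (4 * M) N.
Proof.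
move=> fB rM; have B0 := normc_bound_ge0 fB.
have M0 : 0 <= M by exact: le_trans rM.
have h : ccvg \oo (fun K => SrN r f x K - SrN r f x N) (Sr r f x - SrN r f x N).
  by apply: ccvgD; [exact: Sr_ccvg fB|exact: ccvg_cst].
apply: (ccvg_normc_le h); near=> K.
have NK : (N <= K)%N by near: K; exact: nbhs_infty_ge.
have E n : SrN r f x n = \sum_(0 <= k < n)
    (('i * r%:C) ^+ k) / (k`!)%:R * iter k (@dlap R) f x by rewrite big_mkord.
rewrite !E (big_cat_nat (leq0n N) NK) /= addrAC subrr add0r.
apply: le_trans (ler_normc_sum _ _) _.
apply: le_trans (_ : \sum_(N <= i < K) B * exp_coeff (4 * M) i <= _).
  by apply: ler_sum => i _; exact: normc_SrN_term.
rewrite -mulr_sumr ler_wpM2l // /etail lerBrDl.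
have -> : series (exp_coeff (4 * M)) N + \sum_(N <= i < K) exp_coeff (4 * M) i
   = series (exp_coeff (4 * M)) K by rewrite /series /= -(big_cat_nat (leq0n N) NK).
apply: nondecreasing_cvgn_le; last exact: is_cvg_series_exp_coeff.
apply: nondecreasing_series => n _ _; apply: exp_coeff_ge0; lra.
Unshelve. all: by end_near.
Qed.

(** Case [N = 0] of the tail estimate, where the partial sum is empty. *)
Lemma normc_Sr f B r M x : (forall x, normc (f x) <= B) -> `|r| <= M ->
  normc (Sr r f x) <= B * expR (4 * M).
Proof.
move=> fB rM; have := Sr_tail x 0 fB rM.
by rewrite /SrN /etail /series /= big_ord0 big_geq // !subr0.
Qed.

Lemma iter_dlapD f g n x : iter n (@dlap R) (fun x => f x + g x) x =
  iter n (@dlap R) f x + iter n (@dlap R) g x.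
Proof.
by elim: n x => // n IH x; rewrite !iterS /dlap !IH; ring.
Qed.

Lemma iter_dlapZ (z : C) f n x : iter n (@dlap R) (fun x => z * f x) x =
  z * iter n (@dlap R) f x.
Proof.
by elim: n x => // n IH x; rewrite !iterS /dlap !IH; ring.
Qed.

Lemma iter_dlap_shift f k n x : iter n (@dlap R) (fun x => f (x + k)) x =
  iter n (@dlap R) f (x + k).
Proof.
elim: n x => // n IH x; rewrite !iterS /dlap !IH.
by rewrite (addrAC x 1) (addrAC x (- 1)).
Qed.

Lemma SrD f g Bf Bg r x : (forall x, normc (f x) <= Bf) ->
  (forall x, normc (g x) <= Bg) ->
  Sr r (fun x => f x + g x) x = Sr r f x + Sr r g x.
Proof.
move=> fB gB; apply: ccvg_lim.
rewrite (_ : (fun N => _) = (fun N => SrN r f x N + SrN r g x N)).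
  by apply: ccvgD; [exact: Sr_ccvg fB|exact: Sr_ccvg gB].
apply/funext => N; rewrite -big_split /=; apply: eq_bigr => i _.
by rewrite iter_dlapD mulrDr.
Qed.

Lemma SrZ (z : C) f B r x : (forall x, normc (f x) <= B) ->
  Sr r (fun x => z * f x) x = z * Sr r f x.
Proof.
move=> fB; apply: ccvg_lim.
rewrite (_ : (fun N => _) = (fun N => z * SrN r f x N)).
  by apply: ccvgM; [exact: ccvg_cst|exact: Sr_ccvg fB].
apply/funext => N; rewrite mulr_sumr /=; apply: eq_bigr => i _.
by rewrite iter_dlapZ mulrCA.
Qed.

Lemma Sr_shift f k r x : Sr r (fun x => f (x + k)) x = Sr r f (x + k).
Proof.
congr (lim (_ @ \oo)); apply/funext => N; apply: eq_bigr => i _.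
by rewrite iter_dlap_shift.
Qed.
End Propagator.

(** * Contractivity of the propagator *)

Section Contraction.
Variable R : realType.
Local Notation C := R[i].
Local Notation Re := (@complex.Re R).
Local Notation Im := (@complex.Im R).
Local Notation normc := (@ComplexField.Normc.normc R).
Implicit Types (f g : int -> C) (r M : R).

Lemma ccvg_squeeze0 (T : Type) (F : set_system T) {FF : ProperFilter F}
  (u : T -> C) (v : T -> R) :
  (forall n, normc (u n) <= v n) -> v n @[n --> F] --> 0 -> ccvg F u 0.
Proof.
move=> uv v0.
have main (p : C -> R) : (forall z, `|p z| <= normc z) -> p (u n) @[n --> F] --> 0.
  move=> hp; apply/cvgr0Pnorm_le => e e0.
  move/cvgr0Pnorm_le : v0 => /(_ _ e0); apply: filterS => n; apply: le_trans.
  by apply: le_trans (hp _) (le_trans (uv n) (ler_norm _)).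
by split; apply: main; [exact: Re_le_normc|exact: Im_le_normc].
Qed.

Lemma cvg_win (T : Type) (F : set_system T) {FF : Filter F}
  (a : T -> int -> R) (l : int -> R) N :
  (forall x, a n x @[n --> F] --> l x) -> win (a n) N @[n --> F] --> win l N.
Proof.
move=> al; elim: N => [|N IH].
  by rewrite win0; under eq_fun do rewrite win0; exact: al.
by rewrite winS; under eq_fun do rewrite winS; apply: cvgD => //; exact: cvgD.
Qed.

(** One explicit Euler step for u' = Delta u; it is used with [z] equal to i times a small real time
    step. *)
Definition euler_step (z : C) f : int -> C := fun x => f x + z * dlap f x.

(** Pascal's rule, summed over [k]; this is the induction step of the binomial expansion of (1 + z
    Delta)^n. *)
Lemma binom_recl (a : nat -> C) n :
  \sum_(k < n.+1) 'C(n, k)%:R * (a k + a k.+1) =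
  \sum_(k < n.+2) 'C(n.+1, k)%:R * a k.
Proof.
under eq_bigr do rewrite mulrDr.
rewrite big_split /= [RHS]big_ord_recl /= bin0.
under [in RHS]eq_bigr => k _ do rewrite /bump /= add1n binS natrD mulrDl.
rewrite big_split /= addrA; congr (_ + _).
rewrite [in RHS]big_ord_recr /= bin_small // mul0r addr0.
by rewrite big_ord_recl /= bin0; congr (_ + _); apply: eq_bigr => i _; rewrite /bump add1n.
Qed.

Lemma iter_euler_step (z : C) f n x : iter n (euler_step z) f x =
  \sum_(k < n.+1) 'C(n, k)%:R * (z ^+ k * iter k (@dlap R) f x).
Proof.
elim: n f => [|n IH] f; first by rewrite big_ord1 bin0 !mul1r.
rewrite iterSr IH -(binom_recl (fun k => z ^+ k * iter k (@dlap R) f x)).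
apply: eq_bigr => k _; congr (_ * _).
rewrite iter_dlapD (iter_dlapZ z (dlap f)) -iterSr exprSr; ring.
Qed.

(** The ratio is the product of the factors 1 - j/(n+1) over j < k. Each is at most 1, and the
    product is at least 1 minus the sum of the j/(n+1), hence the bound by k^2/(n+1). *)
Lemma ffact_ratio (n k : nat) : (k <= n.+1)%N ->
  1 - (k%:R ^+ 2) / n.+1%:R <= (n.+1 ^_ k)%:R / (n.+1%:R : R) ^+ k <= 1.
Proof.
have n0 : 0 < n.+1%:R :> R by rewrite ltr0n.
elim: k => [|k IH] kn; first by rewrite ffactn0 expr0 divr1 expr0n /= mul0r subr0 !lexx.
have /andP[h1 h2] := IH (ltnW kn).
rewrite ffactnSr natrM natrB ?(ltnW kn) // [_ ^+ k.+1]exprSr invfM mulrACA.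
have -> : (n.+1%:R - k%:R) / n.+1%:R = 1 - k%:R / n.+1%:R :> R.
  by rewrite mulrBl divff // gt_eqF.
set e := _ / _ ^+ k in h1 h2 *; set q := k%:R / n.+1%:R.
have e0 : 0 <= e by rewrite divr_ge0 // exprn_ge0.
have q0 : 0 <= q by rewrite divr_ge0.
have -> : k.+1%:R ^+ 2 / n.+1%:R = k%:R ^+ 2 / n.+1%:R + 2 * q + n.+1%:R^-1 :> R.
  rewrite /q -(natr1 k); move: (n.+1%:R) n0 => m m0.
  by field; rewrite gt_eqF.
have i0 : 0 <= n.+1%:R^-1 :> R by rewrite invr_ge0.
have h3 := mulr_ge0 e0 q0; have h4 := ler_piMl q0 h2.
move: q0 h1 h2 h3 h4 e0 i0; move: q e (n.+1%:R^-1) => q e i.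
by move: (k%:R ^+ 2 * i) => P *; apply/andP; split; lra.
Qed.

(** Divide [ffact_ratio] by k! and use k^2 <= 4^k, so that the errors sum up to another exponential
    series. *)
Lemma binom_coeff_err (n k : nat) : (k <= n.+1)%N ->
  `|'C(n.+1, k)%:R / n.+1%:R ^+ k - k`!%:R^-1| <=
  n.+1%:R^-1 * (4 ^+ k / k`!%:R) :> R.
Proof.
move=> kn; have /andP[h1 h2] := ffact_ratio kn.
have k0 : 0 < k`!%:R :> R by rewrite ltr0n fact_gt0.
have E : (n.+1 ^_ k)%:R = 'C(n.+1, k)%:R * k`!%:R :> R by rewrite -natrM bin_ffact.
have -> : 'C(n.+1, k)%:R / n.+1%:R ^+ k - k`!%:R^-1 =
    ((n.+1 ^_ k)%:R / n.+1%:R ^+ k - 1) / k`!%:R :> R.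
  rewrite E; move: k0; move: (k`!%:R) => c c0.
  have d0 : 0 < n.+1%:R ^+ k :> R by rewrite exprn_gt0 // ltr0n.
  by move: (n.+1%:R ^+ k) d0 => d d0; field; rewrite !gt_eqF.
rewrite normrM [`|_^-1|]ger0_norm ?invr_ge0 ?ler0n // [leRHS]mulrA.
apply: ler_wpM2r; first by rewrite invr_ge0 ler0n.
rewrite distrC ger0_norm ?subr_ge0 //.
have i0 : 0 <= n.+1%:R^-1 :> R by rewrite invr_ge0.
have hk : k%:R ^+ 2 <= 4 ^+ k :> R.
  rewrite -natrX -[4 ^+ k]natrX ler_nat.
  elim: k {kn h1 h2 k0 E} => // -[|[|k]] // IH.
  by rewrite [leqRHS]expnS; apply: leq_trans (leq_mul (leqnn 4) IH); rewrite -!mulnn; nia.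
apply: le_trans (ler_wpM2l i0 hk); rewrite [leRHS]mulrC; move: h1.
by rewrite lerBlDr -lerBlDl.
Qed.

(** The binomial expansion of n+1 Euler steps is compared termwise with the exponential series; the
    total error is O(1/n). *)
Lemma euler_ccvg f B r x : (forall x, normc (f x) <= B) ->
  ccvg \oo (fun n => iter n.+1 (euler_step ('i * (r / n.+1%:R)%:C)) f x) (Sr r f x).
Proof.
move=> fB; have B0 := normc_bound_ge0 fB.
rewrite -[Sr r f x]add0r.
(* The binomial expansion of the power n+1 has n+2 terms, so the series is cut at [n.+2]. *)
have -> : (fun n => iter n.+1 (euler_step ('i * (r / n.+1%:R)%:C)) f x) =
  (fun n => (iter n.+1 (euler_step ('i * (r / n.+1%:R)%:C)) f x - SrN r f x n.+2)
     + SrN r f x n.+2) by apply/funext => n; rewrite subrK.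
apply: ccvgD; last first.
  have [a b] := Sr_ccvg r x fB.
  by split; [move: a|move: b]; rewrite -(cvg_shiftn 2); under eq_fun do rewrite addn2.
(* In the exponent, 16 = 4 * 4: one factor bounds the Laplacian, the other comes from
   [binom_coeff_err]. *)
apply: (@ccvg_squeeze0 _ _ _ _ (fun n => B * expR (16 * `|r|) * harmonic n)); last first.
  by rewrite -(mulr0 (B * expR (16 * `|r|))); apply: cvgMl_tmp; exact: cvg_harmonic.
move=> n; rewrite iter_euler_step /SrN -sumrB.
apply: le_trans (ler_normc_sum _ _) _.
apply: le_trans (_ : \sum_(k < n.+2) B * harmonic n * exp_coeff (16 * `|r|) k <= _).
  apply: ler_sum => k _; rewrite mulrA -mulrBl.
  have -> : 'C(n.+1, k)%:R * ('i * (r / n.+1%:R)%:C) ^+ k -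
      ('i * r%:C) ^+ k / k`!%:R =
      ('i * r%:C) ^+ k * ('C(n.+1, k)%:R / n.+1%:R ^+ k - k`!%:R^-1)%:C :> C.
    have -> : (r / n.+1%:R)%:C = r%:C / n.+1%:R :> C.
      by rewrite rmorphM fmorphV rmorph_nat.
    have -> : ('C(n.+1, k)%:R / n.+1%:R ^+ k - k`!%:R^-1)%:C =
        'C(n.+1, k)%:R / n.+1%:R ^+ k - k`!%:R^-1 :> C.
      by rewrite rmorphB rmorphM !fmorphV rmorphXn /= !rmorph_nat.
    by rewrite mulrA [(_ / _) ^+ k]exprMn exprVn; ring.
  rewrite !ComplexField.Normc.normcM normcX ComplexField.Normc.normcM normc_i mul1r.
  rewrite !normc_real.
  have h1 := @binom_coeff_err n k (ltn_ord k).
  have h2 := normc_iter_dlap k fB x.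
  rewrite /exp_coeff /= /harmonic.
  have -> : (16 * `|r|) ^+ k = `|r| ^+ k * 4 ^+ k * 4 ^+ k.
    by rewrite -!exprMn; congr (_ ^+ _); ring.
  have -> : B * n.+1%:R^-1 * (`|r| ^+ k * 4 ^+ k * 4 ^+ k / k`!%:R) =
    (`|r| ^+ k * (n.+1%:R^-1 * (4 ^+ k / k`!%:R))) * (4 ^+ k * B) by ring.
  by apply: ler_pM; rewrite ?mulr_ge0 ?exprn_ge0 ?normc_ge0 // ler_wpM2l ?exprn_ge0.
rewrite -mulr_sumr mulrAC ler_wpM2r ?invr_ge0 // ler_wpM2l //.
rewrite -(big_mkord xpredT (fun k => exp_coeff _ k)).
apply: nondecreasing_cvgn_le; last exact: is_cvg_series_exp_coeff.
by apply: nondecreasing_series => m _ _; apply: exp_coeff_ge0; rewrite mulr_ge0.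
Qed.

Lemma bnd_sqc_dlap f A : bnd (@sqc R \o f) A -> bnd (@sqc R \o dlap f) (16 * A).
Proof.
move=> fA N; have p0 x : 0 <= (@sqc R \o f) x by exact: sqc_ge0.
have h1 := bnd_shift 1 p0 fA N; have h2 := bnd_shift (- 1) p0 fA N.
have h3 := fA N.
apply: le_trans (_ : win (fun x => 4 * (@sqc R \o f) (x + 1) +
  (4 * (@sqc R \o f) (x - 1) + 8 * (@sqc R \o f) x)) N <= _).
  apply: ler_win => x /=; rewrite /sqc /dlap !reimE.
  move: (Re (f x)) (Re (f (x + 1))) (Re (f (x - 1))) => a b c.
  move: (Im (f x)) (Im (f (x + 1))) (Im (f (x - 1))) => a' b' c'.
  (* The difference of the two sides is (u - v)^2 + 2 (u + w)^2 + 2 (v + w)^2. The weights add up to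
     4 + 4 + 8 = 16. *)
  have H (u v w : R) : (u + v - 2 * w) ^+ 2 <= 4 * u ^+ 2 + 4 * v ^+ 2 + 8 * w ^+ 2.
    have := sqr_ge0 (u - v); have := sqr_ge0 (u + w); have := sqr_ge0 (v + w).
    by rewrite !expr2; lra.
  by have := H b c a; have := H b' c' a'; lra.
by rewrite !winD !winZ; lra.
Qed.

(* The cross term [2 Re (f^* i s Delta f)] is the divergence of the current
   [Im (f(x-1)^* f(x))], so it telescopes and only vanishing boundary terms remain. *)
Lemma bnd_euler_step f A (s : R) : bnd (@sqc R \o f) A ->
  bnd (@sqc R \o euler_step ('i * s%:C) f) (A * (1 + 16 * s ^+ 2)).
Proof.
move=> fA; have p0 x : 0 <= (@sqc R \o f) x by exact: sqc_ge0.
pose k x := Re (f (x - 1)) * Im (f x) - Im (f (x - 1)) * Re (f x).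
have E x : (@sqc R \o euler_step ('i * s%:C) f) x = (@sqc R \o f) x +
    (s ^+ 2 * (@sqc R \o dlap f) x + 2 * s * (k x + (- 1) * k (x + 1))).
  by rewrite /= /k addrK /sqc /euler_step /dlap !reimE /=; ring.
have kle x : 2 * `|k x| <= (@sqc R \o f) x + (@sqc R \o f) (x - 1).
  rewrite /k /sqc /=; move: (Re (f x)) (Re (f (x - 1))) => a c.
  move: (Im (f x)) (Im (f (x - 1))) => a' c'.
  have := sqr_ge0 (a - c'); have := sqr_ge0 (a + c'); have := sqr_ge0 (a' - c).
  have := sqr_ge0 (a' + c); rewrite !expr2.
  by case: (ler0P (c * a' - c' * a)); lra.
(* An upper bound for the two boundary terms of the telescoped current; it tends to 0 because [f] is
   square summable. *)
pose e (N : nat) := `|s| * ((@sqc R \o f) (- N%:Z) + (@sqc R \o f) (- (N%:Z + 1))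
   + ((@sqc R \o f) (N%:Z + 1) + (@sqc R \o f) N%:Z)).
have e0 : e @ \oo --> 0.
  have -> : 0 = `|s| * (0 + 0 + (0 + 0)) :> R by rewrite !addr0 mulr0.
  apply: cvgMl_tmp; apply: cvgD; apply: cvgD.
  - exact: (bnd_cvg0 (a := fun x => (@sqc R \o f) (- x)) (fun x => p0 (- x)) (bnd_opp fA)).
  - apply: (bnd_cvg0 (a := fun x => (@sqc R \o f) (- (x + 1))) (fun x => p0 _)).
    exact: (@bnd_shift1 _ (fun x => (@sqc R \o f) (- x)) _ (fun x => p0 (- x)) (bnd_opp fA)).
  - exact: (bnd_cvg0 (a := fun x => (@sqc R \o f) (x + 1)) (fun x => p0 _) (bnd_shift1 p0 fA)).
  - exact: bnd_cvg0 fA.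
move=> N.
(* The boundary terms vanish only in the limit, so the window [N] is first enlarged to [K], and then
   [K] tends to infinity. *)
have lim1 : (fun K => A * (1 + 16 * s ^+ 2) + e K) @ \oo --> A * (1 + 16 * s ^+ 2).
  by rewrite -[X in _ --> X]addr0; apply: cvgD; [exact: cvg_cst|exact: e0].
rewrite -(cvg_lim (@Rhausdorff _) lim1); apply: limr_ge.
  by apply/cvg_ex; exists (A * (1 + 16 * s ^+ 2)).
near=> K.
have NK : (N <= K)%N by near: K; exact: nbhs_infty_ge.
apply: le_trans (nondecreasing_win _ NK) _; first by move=> x; exact: sqc_ge0.
rewrite (eq_win _ E) (winD (@sqc R \o f)).
rewrite (winD (fun x => s ^+ 2 * (@sqc R \o dlap f) x)).
rewrite (winZ _ (@sqc R \o dlap f)) (winZ _ (fun x => k x + (- 1) * k (x + 1))).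
rewrite (winD k) (winZ _ (fun x => k (x + 1))) win_shift.
have h1 := fA K; have h2 := bnd_sqc_dlap fA K.
have h3 := ler_wpM2l (sqr_ge0 s) h2.
have -> : win k K + -1 * (win k K + k K.+1%:Z - k (- K%:Z)) = k (- K%:Z) - k K.+1%:Z by ring.
have h4 : 2 * s * (k (- K%:Z) - k K.+1%:Z) <= e K.
  have := kle (- K%:Z); have := kle K.+1%:Z.
  have -> : K.+1%:Z - 1 = K%:Z by lia.
  have -> : K.+1%:Z = K%:Z + 1 by lia.
  have -> : - K%:Z - 1 = - (K%:Z + 1) by lia.
  rewrite /e; set p1 := k _; set p2 := k _ => l1 l2.
  apply: le_trans (ler_norm _) _; rewrite !normrM (ger0_norm (_ : 0 <= 2)) //.
  rewrite mulrAC [X in X <= _]mulrC ler_wpM2l //.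
  by have := ler_normB p2 p1; lra.
lra.
Unshelve. all: by end_near.
Qed.

Lemma bnd_normc f A : bnd (@sqc R \o f) A -> forall x, normc (f x) <= Num.sqrt A.
Proof.
move=> fA x; rewrite normc_sqrt ler_wsqrtr //.
by apply: (@bnd_term _ (@sqc R \o f)) => // y; exact: sqc_ge0.
Qed.

(** With n+1 steps of size r/(n+1) the squared norm grows at most by (1 + 16 r^2/(n+1)^2)^(n+1) <=
    exp(16 r^2/(n+1)), which tends to 1; the bound passes to the limit in each window. *)
Lemma bnd_Sr f A r : bnd (@sqc R \o f) A -> bnd (@sqc R \o Sr r f) A.
Proof.
move=> fA N.
have A0 : 0 <= A by apply: bnd_ge0 fA => x; exact: sqc_ge0.
have lim1 : (fun n => win (@sqc R \o iter n.+1 (euler_step ('i * (r / n.+1%:R)%:C)) f) N)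
   @ \oo --> win (@sqc R \o Sr r f) N.
  apply: cvg_win => x.
  by apply: (@ccvg_sqc _ _ \oo); exact: euler_ccvg (bnd_normc fA).
have lim2 : (fun n => A * expR (16 * r ^+ 2 * harmonic n)) @ \oo --> A.
  have E : A * expR (16 * r ^+ 2 * 0) = A by rewrite mulr0 expR0 mulr1.
  rewrite -[X in _ --> X]E.
  apply: (cvgMl_tmp (g := fun n => expR (16 * r ^+ 2 * harmonic n))).
  apply: (cvg_comp (fun n => 16 * r ^+ 2 * harmonic n) expR (G := nbhs (16 * r ^+ 2 * 0)));
    last exact: continuous_expR.
  by apply: (cvgMl_tmp (g := harmonic)); exact: cvg_harmonic.
apply: (ler_cvg_to lim1 lim2); apply: nearW => n.
have it m s : bnd (@sqc R \o iter m (euler_step ('i * s%:C)) f) (A * (1 + 16 * s ^+ 2) ^+ m).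
  elim: m => [|m IH]; first by rewrite mulr1.
  by rewrite exprSr mulrA iterS; exact: bnd_euler_step.
apply: le_trans (it _ _ N) _; rewrite ler_wpM2l //.
have -> : 16 * r ^+ 2 * harmonic n = (16 * (r / n.+1%:R) ^+ 2) * n.+1%:R.
  have n0 : n.+1%:R != 0 :> R by rewrite pnatr_eq0.
  by rewrite /harmonic /=; move: (n.+1%:R) n0 => m m0; field.
rewrite expRM_natr.
rewrite lerXn2r ?nnegrE ?expR_ge0 ?expR_ge1Dx //.
by rewrite addr_ge0 // mulr_ge0 // sqr_ge0.
Qed.
End Contraction.

(** * The quartic form *)

Section Integral.
Variables (R : realType) (mu : {measure set R -> \bar R}).
Local Notation C := R[i].
Local Notation Re := (@complex.Re R).
Local Notation Im := (@complex.Im R).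
Local Notation normc := (@ComplexField.Normc.normc R).
Implicit Types (f g : int -> C) (h k : R -> R) (r M : R).

(** An algebra of functions, all integrable since [mu] is finite; every integrand below belongs to
    it. *)
Definition bmeas h := measurable_fun [set: R] h /\ exists B, forall r, `|h r| <= B.

Lemma bmeas_cst (a : R) : bmeas (fun=> a).
Proof. by split; [exact: measurable_cst | exists `|a|]. Qed.

Lemma bmeasD h k : bmeas h -> bmeas k -> bmeas (fun r => h r + k r).
Proof.
move=> [mh [B hB]] [mk [D kD]]; split; first exact: measurable_funD.
by exists (B + D) => r; apply: le_trans (ler_normD _ _) _; exact: lerD.
Qed.

Lemma bmeasM h k : bmeas h -> bmeas k -> bmeas (fun r => h r * k r).
Proof.
move=> [mh [B hB]] [mk [D kD]]; split; first exact: measurable_funM.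
by exists (B * D) => r; rewrite normrM; apply: ler_pM.
Qed.

Lemma bmeasZ (a : R) h : bmeas h -> bmeas (fun r => a * h r).
Proof. by move=> ?; apply: bmeasM => //; exact: bmeas_cst. Qed.

Lemma bmeasX h n : bmeas h -> bmeas (fun r => h r ^+ n).
Proof.
move=> gh; elim: n => [|n IH]; first by under eq_fun do rewrite expr0; exact: bmeas_cst.
by under eq_fun do rewrite exprS; exact: bmeasM.
Qed.

Lemma bmeas_win (h : int -> R -> R) N : (forall x, bmeas (h x)) ->
  bmeas (fun r => win (fun x => h x r) N).
Proof.
move=> gh; elim: N => [|N IH]; first by under eq_fun do rewrite win0; exact: gh.
by under eq_fun do rewrite winS; apply: bmeasD => //; exact: bmeasD.
Qed.

Definition mint h : R := \int[mu]_r h r.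
Definition mass : R := fine (mu [set: R]).
Hypothesis fin_mu : (mu [set: R] < +oo)%E.
Local Notation I := mint.
Local Notation m := mass.

Lemma bmeas_integrable h : bmeas h -> mu.-integrable [set: R] (EFin \o h).
Proof.
move=> [mh [B hB]]; apply: measurable_bounded_integrable => //.
by exists B; split; [exact: num_real|] => x Bx r _ /=; exact: le_trans (hB r) (ltW Bx).
Qed.

Lemma mass_ge0 : 0 <= m. Proof. exact: fine_ge0. Qed.

Lemma integral_D h k : bmeas h -> bmeas k -> I (fun r => h r + k r) = I h + I k.
Proof. by move=> gh gk; apply: RintegralD => //; exact: bmeas_integrable. Qed.

Lemma integral_Z a h : bmeas h -> I (fun r => a * h r) = a * I h.
Proof. by move=> gh; apply: RintegralZl => //; exact: bmeas_integrable. Qed.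

Lemma ler_integral h k : bmeas h -> bmeas k -> (forall r, h r <= k r) -> I h <= I k.
Proof. by move=> gh gk hk; apply: le_Rintegral => //; exact: bmeas_integrable. Qed.

Lemma integral_cst a : I (fun=> a) = a * m.
Proof. exact: Rintegral_cst. Qed.

Lemma integral_ge0 h : (forall r, 0 <= h r) -> 0 <= I h.
Proof. by move=> h0; apply: Rintegral_ge0. Qed.

Lemma ler_norm_integral h k : bmeas h -> bmeas k -> (forall r, `|h r| <= k r) ->
  `|I h| <= I k.
Proof.
move=> gh gk hk; rewrite ler_norml -[- I k]mulN1r -integral_Z //.
apply/andP; split; apply: ler_integral => //; try exact: bmeasZ.
  by move=> r; have := hk r; rewrite ler_norml mulN1r => /andP[].
by move=> r; have := hk r; rewrite ler_norml => /andP[].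
Qed.

Lemma win_integral (h : int -> R -> R) N : (forall x, bmeas (h x)) ->
  win (fun x => I (h x)) N = I (fun r => win (fun x => h x r) N).
Proof.
move=> gh; elim: N => [|N IH].
  by rewrite win0; congr I; apply/funext => r; rewrite win0.
rewrite winS IH -integral_D //; last exact: bmeas_win.
rewrite -integral_D //; last by apply: bmeasD => //; exact: bmeas_win.
by congr I; apply/funext => r; rewrite winS.
Qed.

(** Local bounds on [S_r] are uniform only for bounded [r]; the remaining times form a null set,
    which is removed from both integrals. *)
Lemma ler_integral_supp M h k : mu [set r | M < `|r|] = 0%E ->
  bmeas h -> bmeas k -> (forall r, `|r| <= M -> h r <= k r) -> I h <= I k.
Proof.
move=> M0 gh gk hk.
have mN : measurable [set r : R | M < `|r|].
  have -> : [set r : R | M < `|r|] = [set: R] `&` (@Num.norm R R) @^-1` `]M, +oo[%classic.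
    by rewrite setTI; apply/seteqP; split => r /=; rewrite in_itv /= andbT.
  apply: normr_measurable => //; exact: measurable_itv.
have E u : bmeas u -> I u = \int[mu]_(r in [set: R] `\` [set r | M < `|r|]) u r.
  move=> gu; rewrite /mint /Rintegral; congr fine.
  apply: (@negligible_integral _ _ _ mu [set: R] [set r | M < `|r|]) => //.
  exact: bmeas_integrable.
rewrite !E //; apply: le_Rintegral.
- exact: measurableD.
- apply: integrableS (bmeas_integrable gh) => //; exact: measurableD.
- apply: integrableS (bmeas_integrable gk) => //; exact: measurableD.
- by move=> r [_] /= /negP; rewrite -leNgt; exact: hk.
Qed.

Lemma Re_realM (a : R) (z : C) : Re (a%:C * z) = a * Re z.
Proof. by rewrite ReM /= mul0r subr0. Qed.

Lemma Im_realM (a : R) (z : C) : Im (a%:C * z) = a * Im z.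
Proof. by rewrite ImM /= mul0r addr0. Qed.

(** Boundedness is contractivity. Measurability holds because the partial sums are polynomials in
    [r] and converge pointwise. *)
Lemma bmeas_Sr (p : C -> R) f A x : bnd (@sqc R \o f) A ->
  (p = Re \/ p = Im) -> bmeas (fun r => p (Sr r f x)).
Proof.
move=> fA hp; have fB := bnd_normc fA; split; last first.
  exists (Num.sqrt A) => r; have := bnd_normc (bnd_Sr r fA) x.
  by apply: le_trans; case: hp => ->; [exact: Re_le_normc|exact: Im_le_normc].
apply: (@measurable_fun_cvg _ _ _ _ (fun N r => p (SrN r f x N))); last first.
  by move=> r _; have [a b] := Sr_ccvg r x fB; case: hp => ->.
move=> N.
have -> : (fun r => p (SrN r f x N)) =
  (fun r => \sum_(n < N) r ^+ n * p ('i ^+ n / (n`!)%:R * iter n (@dlap R) f x)).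
  apply/funext => r; rewrite /SrN.
  have E n : ('i * r%:C) ^+ n / (n`!)%:R * iter n (@dlap R) f x =
    (r ^+ n)%:C * ('i ^+ n / (n`!)%:R * iter n (@dlap R) f x).
    by rewrite exprMn rmorphXn /=; ring.
  case: hp => ->.
    apply: etrans (Re_sum _ _) _; apply: eq_bigr => n _.
    exact: etrans (congr1 _ (E n)) (Re_realM _ _).
  apply: etrans (Im_sum _ _) _; apply: eq_bigr => n _.
  exact: etrans (congr1 _ (E n)) (Im_realM _ _).
elim: N => [|N IH]; first by under eq_fun do rewrite big_ord0; exact: measurable_cst.
under eq_fun do rewrite big_ord_recr /=.
apply: measurable_funD => //; apply: measurable_funM; last exact: measurable_cst.
exact: exprn_measurable.
Qed.

Lemma bmeas_sqc_Sr f A x : bnd (@sqc R \o f) A -> bmeas (fun r => sqc (Sr r f x)).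
Proof.
move=> fA; apply: bmeasD; apply: bmeasX.
  by apply: (bmeas_Sr x fA); left.
by apply: (bmeas_Sr x fA); right.
Qed.

(* [rdot z w] is the real part of [z^* w]. *)
Definition rdot (z w : C) : R := Re z * Re w + Im z * Im w.

Lemma bmeas_rdot_Sr f g A B x : bnd (@sqc R \o f) A -> bnd (@sqc R \o g) B ->
  bmeas (fun r => rdot (Sr r g x) (Sr r f x)).
Proof.
move=> fA gB; apply: bmeasD; apply: bmeasM.
- by apply: (bmeas_Sr x gB); left.
- by apply: (bmeas_Sr x fA); left.
- by apply: (bmeas_Sr x gB); right.
- by apply: (bmeas_Sr x fA); right.
Qed.

(** * Sitewise densities and bounds on the quartic form *)

Definition mass2 f x : R := I (fun r => sqc (Sr r f x)).
Definition quartic f x : R := I (fun r => sqc (Sr r f x) ^+ 2).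
Definition qform f : R := sm (quartic f).
(** The real part of the summand of [Qd mu g f f f] at [x]; it is a quarter of the derivative of
    [quartic] at [f] in the direction [g]. *)
Definition qdiff g f x : R :=
  I (fun r => sqc (Sr r f x) * rdot (Sr r g x) (Sr r f x)).

Lemma mass2_ge0 f x : 0 <= mass2 f x.
Proof. by apply: integral_ge0 => r; exact: sqc_ge0. Qed.

Lemma quartic_ge0 f x : 0 <= quartic f x.
Proof. by apply: integral_ge0 => r; exact: sqr_ge0. Qed.

(** Exchange the finite sum with the integral; for each [r] the total mass of [Sr r f] is at most
    [A]. *)
Lemma bnd_mass2 f A : bnd (@sqc R \o f) A -> bnd (mass2 f) (A * m).
Proof.
move=> fA N; rewrite /mass2 win_integral => [|x]; last exact: bmeas_sqc_Sr fA.
rewrite -integral_cst; apply: ler_integral; [|exact: bmeas_cst|].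
  by apply: bmeas_win => x; exact: bmeas_sqc_Sr fA.
by move=> r; exact: (bnd_Sr r fA).
Qed.

(** One of the two factors |S_r f|^2 is bounded by the whole l^2 mass. *)
Lemma quartic_le f A x : bnd (@sqc R \o f) A -> quartic f x <= A * mass2 f x.
Proof.
move=> fA; have gf := bmeas_sqc_Sr x fA.
rewrite /quartic /mass2 -integral_Z //; apply: ler_integral.
- exact: bmeasX.
- exact: bmeasZ.
move=> r; rewrite expr2 ler_wpM2r ?sqc_ge0 //.
by apply: (@bnd_term _ (@sqc R \o Sr r f)); [move=> y; exact: sqc_ge0|exact: bnd_Sr].
Qed.

Lemma bnd_quartic f A : bnd (@sqc R \o f) A -> bnd (quartic f) (A * (A * m)).
Proof.
move=> fA N; apply: le_trans (ler_win _ (fun x => quartic_le x fA)) _.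
rewrite winZ ler_wpM2l ?bnd_mass2 //.
by apply: bnd_ge0 fA => x; exact: sqc_ge0.
Qed.

Lemma qform_le f A : bnd (@sqc R \o f) A -> qform f <= A * (A * m).
Proof. by move=> fA; apply: sm_le (quartic_ge0 f) _; exact: bnd_quartic. Qed.

(** As for [qform_le], but one factor |S_r f|^2 is now bounded through the sup norm of [f]; this is
    what prevents maximizing sequences from flattening out. *)
Lemma qform_sup f A M c : mu [set r | M < `|r|] = 0%E -> 0 <= M ->
  bnd (@sqc R \o f) A -> 0 <= c -> (forall x, sqc (f x) <= c) ->
  qform f <= c * expR (4 * M) ^+ 2 * (A * m).
Proof.
move=> M0 M_ge0 fA c0 fc; apply: sm_le (quartic_ge0 f) _ => N.
have fB x : normc (f x) <= Num.sqrt c by rewrite normc_sqrt ler_wsqrtr.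
apply: le_trans (_ : win (fun x => c * expR (4 * M) ^+ 2 * mass2 f x) N <= _).
  apply: ler_win => x; have gf := bmeas_sqc_Sr x fA.
  rewrite /quartic /mass2 -integral_Z //; apply: (ler_integral_supp M0).
  - exact: bmeasX.
  - exact: bmeasZ.
  move=> r rM; rewrite expr2 ler_wpM2r ?sqc_ge0 // -sqr_normc.
  rewrite -(sqr_sqrtr c0) -exprMn lerXn2r ?nnegrE ?normc_ge0 //.
  exact: normc_Sr.
rewrite winZ ler_wpM2l ?bnd_mass2 // mulr_ge0 //; exact: sqr_ge0.
Qed.

Lemma qformZ (z : C) f A : bnd (@sqc R \o f) A ->
  qform (fun x => z * f x) = sqc z ^+ 2 * qform f.
Proof.
move=> fA; have E x : quartic (fun x => z * f x) x = sqc z ^+ 2 * quartic f x.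
  rewrite /quartic -integral_Z; last by apply: bmeasX; exact: bmeas_sqc_Sr fA.
  congr I; apply/funext => r; rewrite (SrZ _ _ _ (bnd_normc fA)) sqcM; ring.
apply: etrans (congr1 (@sm R) (funext E)) _.
exact: smZ (quartic_ge0 f) (bnd_quartic fA).
Qed.

Lemma qform_shift f A (k : int) : bnd (@sqc R \o f) A ->
  qform (fun x => f (x + k)) = qform f.
Proof.
move=> fA; have E x : quartic (fun x => f (x + k)) x = quartic f (x + k).
  by rewrite /quartic; congr I; apply/funext => r; rewrite Sr_shift.
apply: etrans (congr1 (@sm R) (funext E)) _.
exact: sm_shift (quartic_ge0 f) (bnd_quartic fA).
Qed.

Lemma rdot_le (z w : C) : `|rdot z w| <= sqc z + sqc w.
Proof.
rewrite /rdot /sqc; move: (Re z) (Im z) (Re w) (Im w) => a b c d.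
have := sqr_ge0 (a - c); have := sqr_ge0 (a + c); have := sqr_ge0 (b - d).
have := sqr_ge0 (b + d); rewrite !expr2.
by case: (ler0P (a * c + b * d)); lra.
Qed.

Lemma bmeas_qdiff f g A B x : bnd (@sqc R \o f) A -> bnd (@sqc R \o g) B ->
  bmeas (fun r => sqc (Sr r f x) * rdot (Sr r g x) (Sr r f x)).
Proof.
move=> fA gB; apply: bmeasM; first exact: bmeas_sqc_Sr fA.
exact: bmeas_rdot_Sr fA gB.
Qed.

Lemma cvg_qdiff f g A B : bnd (@sqc R \o f) A -> bnd (@sqc R \o g) B ->
  cvgn (win (qdiff g f)).
Proof.
move=> fA gB; apply: (@cvg_abs_bnd _ _ (A * (B * m + A * m))) => N.
have A0 : 0 <= A by apply: bnd_ge0 fA => x; exact: sqc_ge0.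
apply: le_trans (_ : win (fun x => A * (mass2 g x + mass2 f x)) N <= _).
  apply: ler_win => x; have gf := bmeas_sqc_Sr x fA; have gg := bmeas_sqc_Sr x gB.
  rewrite /mass2 -integral_D // -integral_Z; last exact: bmeasD.
  apply: ler_norm_integral.
  - exact: bmeas_qdiff fA gB.
  - by apply: bmeasZ; exact: bmeasD.
  move=> r; rewrite normrM ger0_norm ?sqc_ge0 //; apply: ler_pM => //.
  - exact: sqc_ge0.
  - by apply: (@bnd_term _ (@sqc R \o Sr r f)); [move=> y; exact: sqc_ge0|exact: bnd_Sr].
  - exact: rdot_le.
rewrite winZ winD ler_wpM2l // lerD //; exact: bnd_mass2.
Qed.

Lemma qform_convex f g A B (t : R) : bnd (@sqc R \o f) A -> bnd (@sqc R \o g) B ->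
  forall D, bnd (@sqc R \o (fun x => f x + t%:C * g x)) D ->
  qform f + 4 * t * limn (win (qdiff g f)) <= qform (fun x => f x + t%:C * g x).
Proof.
move=> fA gB D fgD.
have cf := cvg_bnd (quartic_ge0 f) (bnd_quartic fA).
have cg := cvg_qdiff fA gB.
have cfg := cvg_bnd (quartic_ge0 _) (bnd_quartic fgD).
have h : (fun N => win (quartic f) N + 4 * t * win (qdiff g f) N) @ \oo -->
    qform f + 4 * t * limn (win (qdiff g f)).
  exact: (cvgD cf (cvgMl_tmp (a := 4 * t) cg)).
apply: (ler_cvg_to h cfg); apply: nearW => N.
rewrite -winZ -winD; apply: ler_win => x.
rewrite /qdiff -integral_Z; last exact: bmeas_qdiff fA gB.
rewrite -integral_D; first last.
- by apply: bmeasZ; exact: bmeas_qdiff fA gB.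
- by apply: bmeasX; exact: bmeas_sqc_Sr fA.
apply: ler_integral.
- apply: bmeasD; first by apply: bmeasX; exact: bmeas_sqc_Sr fA.
  by apply: bmeasZ; exact: bmeas_qdiff fA gB.
- by apply: bmeasX; exact: bmeas_sqc_Sr fgD.
have tB : forall x, normc (t%:C * g x) <= `|t| * Num.sqrt B.
  move=> y; rewrite ComplexField.Normc.normcM normc_real ler_wpM2l //.
  exact: (bnd_normc gB).
move=> r; rewrite (SrD _ _ (bnd_normc fA) tB) (SrZ _ _ _ (bnd_normc gB)).
rewrite /sqc /rdot !reimE /=.
move: (Re (Sr r f x)) (Im (Sr r f x)) (Re (Sr r g x)) (Im (Sr r g x)) => a b c d.
(* With z = S_r f and w = t S_r g, the defect |z + w|^4 - |z|^4 - 4 |z|^2 Re(conj(z) w) equals (|z +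
   w|^2 - |z|^2)^2 + 2 |z|^2 |w|^2. *)
have h1 := sqr_ge0 ((a + t * c) ^+ 2 + (b + t * d) ^+ 2 - (a ^+ 2 + b ^+ 2)).
have h2 : 0 <= (a ^+ 2 + b ^+ 2) * ((t * c) ^+ 2 + (t * d) ^+ 2).
  by rewrite mulr_ge0 // addr_ge0 // sqr_ge0.
rewrite -subr_ge0; apply: le_trans (addr_ge0 h1 (addr_ge0 h2 h2)) _.
rewrite le_eqVlt; apply/orP; left; apply/eqP; ring.
Qed.

(** * Squared norm, real inner product and the link with [Qd] *)

Definition nrm f : R := sm (@sqc R \o f).

Lemma bndZ (z : C) f A : bnd (@sqc R \o f) A ->
  bnd (@sqc R \o (fun x => z * f x)) (sqc z * A).
Proof.
move=> fA N; rewrite (eq_win _ (fun x => sqcM z (f x))).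
rewrite (winZ _ (@sqc R \o f)); apply: ler_wpM2l; first exact: sqc_ge0.
exact: fA.
Qed.

Lemma bndD f g A B : bnd (@sqc R \o f) A -> bnd (@sqc R \o g) B ->
  bnd (@sqc R \o (fun x => f x + g x)) (2 * A + 2 * B).
Proof.
move=> fA gB N.
apply: le_trans (_ : win (fun x => 2 * (@sqc R \o f) x + 2 * (@sqc R \o g) x) N <= _).
  apply: ler_win => x /=; rewrite /sqc !reimE.
  move: (Re (f x)) (Im (f x)) (Re (g x)) (Im (g x)) => a b c d.
  by have := sqr_ge0 (a - c); have := sqr_ge0 (b - d); rewrite !expr2; lra.
rewrite (winD (fun x => 2 * (@sqc R \o f) x)) (winZ _ (@sqc R \o f)) (winZ _ (@sqc R \o g)).
by have := fA N; have := gB N; lra.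
Qed.

Lemma sqc_comp_ge0 f x : 0 <= (@sqc R \o f) x.
Proof. exact: sqc_ge0. Qed.
#[local] Hint Resolve sqc_comp_ge0 : core.

Lemma bnd_nrm f A : bnd (@sqc R \o f) A -> bnd (@sqc R \o f) (nrm f).
Proof. exact: bnd_sm. Qed.

Lemma nrm_ge0 f A : bnd (@sqc R \o f) A -> 0 <= nrm f.
Proof. by move=> fA; apply: bnd_ge0 (bnd_nrm fA). Qed.

Lemma nrmZ (z : C) f A : bnd (@sqc R \o f) A -> nrm (fun x => z * f x) = sqc z * nrm f.
Proof.
move=> fA; apply: etrans (congr1 (@sm R) (funext (fun x => sqcM z (f x)))) _.
exact: (@smZ R (sqc z) (@sqc R \o f)) fA.
Qed.

Lemma nrm_shift (k : int) f A : bnd (@sqc R \o f) A -> nrm (fun x => f (x + k)) = nrm f.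
Proof. exact: sm_shift. Qed.

Definition rip g f : R := limn (win (fun x => rdot (g x) (f x))).

Lemma cvg_rip f g A B : bnd (@sqc R \o f) A -> bnd (@sqc R \o g) B ->
  cvgn (win (fun x => rdot (g x) (f x))).
Proof.
move=> fA gB; apply: (@cvg_abs_bnd _ _ (B + A)) => N.
apply: le_trans (ler_win _ (fun x => rdot_le (g x) (f x))) _.
by rewrite (winD (@sqc R \o g)); apply: lerD; [exact: gB|exact: fA].
Qed.

Lemma nrmD f g A B : bnd (@sqc R \o f) A -> bnd (@sqc R \o g) B ->
  nrm (fun x => f x + g x) = nrm f + 2 * rip g f + nrm g.
Proof.
move=> fA gB; apply: cvg_lim; first exact: Rhausdorff.
have -> : win (@sqc R \o (fun x => f x + g x)) = (fun N => win (@sqc R \o f) N +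
   2 * win (fun x => rdot (g x) (f x)) N + win (@sqc R \o g) N).
  apply/funext => N; rewrite -winZ -!winD; apply: eq_win => x.
  by rewrite /= /sqc /rdot !reimE; ring.
apply: cvgD; last exact: cvg_bnd gB.
apply: cvgD; first exact: cvg_bnd fA.
exact: (cvgMl_tmp (a := 2) (cvg_rip fA gB)).
Qed.

Lemma ripZl (t : R) f g A B : bnd (@sqc R \o f) A -> bnd (@sqc R \o g) B ->
  rip (fun x => t%:C * g x) f = t * rip g f.
Proof.
move=> fA gB; apply: cvg_lim; first exact: Rhausdorff.
have -> : win (fun x => rdot (t%:C * g x) (f x)) =
   (fun N => t * win (fun x => rdot (g x) (f x)) N).
  apply/funext => N; rewrite -winZ; apply: eq_win => x.
  by rewrite /rdot Re_realM Im_realM; ring.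
exact: (cvgMl_tmp (a := t) (cvg_rip fA gB)).
Qed.

Lemma eq_cvgn (u v : R^nat) (l : R) : u =1 v -> v @ \oo --> l -> u @ \oo --> l.
Proof. by move=> /funext ->. Qed.

(** Since conj(i g) f = - i conj(g) f, an imaginary part is a real part with [g] replaced by i g.
    The same device serves for [Qd_eq]. *)
Lemma inner_eq f g A B : bnd (@sqc R \o f) A -> bnd (@sqc R \o g) B ->
  inner g f = rip g f +i* rip (fun x => 'i * g x) f.
Proof.
move=> fA gB; have iB := bndZ 'i gB.
apply: ccvg_lim; split.
  apply: (eq_cvgn _ (cvg_rip fA gB)) => N.
  apply: etrans (Re_win (fun x => (g x)^* * f x) N) _; apply: eq_win => x.
  by rewrite /rdot !reimE; ring.
apply: (eq_cvgn _ (cvg_rip fA iB)) => N.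
apply: etrans (Im_win (fun x => (g x)^* * f x) N) _; apply: eq_win => x.
by rewrite /rdot !reimE /=; ring.
Qed.

Lemma Qd_eq f g A B : bnd (@sqc R \o f) A -> bnd (@sqc R \o g) B ->
  Qd mu g f f f =
    limn (win (qdiff g f)) +i* limn (win (qdiff (fun x => 'i * g x) f)).
Proof.
move=> fA gB; have iB := bndZ 'i gB.
pose F x := Cintegral mu (fun r =>
  (Sr r g x)^* * Sr r f x * (Sr r f x)^* * Sr r f x).
apply: ccvg_lim; split.
  apply: (eq_cvgn _ (cvg_qdiff fA gB)) => N.
  apply: etrans (Re_win F N) _; apply: eq_win => x.
  apply: (congr1 I); apply/funext => r; rewrite /sqc /rdot !reimE; ring.
apply: (eq_cvgn _ (cvg_qdiff fA iB)) => N.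
apply: etrans (Im_win F N) _; apply: eq_win => x.
apply: (congr1 I); apply/funext => r; rewrite (SrZ _ _ _ (bnd_normc gB)).
by rewrite /sqc /rdot !reimE /=; ring.
Qed.

Lemma Qd_diag f A : bnd (@sqc R \o f) A -> Qd mu f f f f = (qform f)%:C.
Proof.
move=> fA.
have e1 : qdiff f f = quartic f.
  apply/funext => x; apply: (congr1 I); apply/funext => r.
  by rewrite /rdot /sqc; ring.
(* conj(f) f is real, so pairing with i f contributes nothing. *)
have e2 : qdiff (fun x => 'i * f x) f = fun=> 0.
  apply/funext => x; apply: etrans (_ : I (fun=> 0) = 0); last by rewrite integral_cst mul0r.
  apply: (congr1 I); apply/funext => r; rewrite (SrZ _ _ _ (bnd_normc fA)).
  by rewrite /sqc /rdot !reimE /=; ring.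
have e3 : limn (win (fun=> 0 : R)) = 0.
  apply: cvg_lim; first exact: Rhausdorff.
  have -> : win (fun=> 0 : R) = (fun=> 0) by apply/funext => N; rewrite /win big1.
  exact: cvg_cst.
by rewrite (Qd_eq fA fA) e1 e2 e3.
Qed.

(** Rescale [h] to mass [lam]: [qform] is homogeneous of degree 2 in the squared norm. Mass zero
    cannot be rescaled, and there [qform_le] gives the bound 0. *)
Lemma qform_le_nrm (lam p : R) : 0 < lam ->
  (forall (h : int -> C) A, bnd (@sqc R \o h) A -> nrm h = lam -> qform h <= p) ->
  forall (h : int -> C) A, bnd (@sqc R \o h) A -> qform h <= p / lam ^+ 2 * nrm h ^+ 2.
Proof.
move=> lam0 hp h A hA; have hn := bnd_nrm hA.
have [n0|] := eqVneq (nrm h) 0.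
  have := qform_le hn; rewrite n0 !mul0r expr0n /= mulr0; exact.
rewrite neq_lt ltNge (nrm_ge0 hA) /= => n0.
pose s := Num.sqrt (lam / nrm h).
have ss : sqc s%:C = lam / nrm h.
  by rewrite /sqc /= expr0n addr0 sqr_sqrtr // divr_ge0 // ltW.
have := hp _ _ (bndZ s%:C hA); rewrite (nrmZ _ hA) (qformZ _ hA) ss.
rewrite divfK ?gt_eqF // => /(_ erefl) H.
have -> : p / lam ^+ 2 * nrm h ^+ 2 = p / (lam / nrm h) ^+ 2.
  by field; rewrite !gt_eqF.
by rewrite ler_pdivlMr ?exprn_gt0 ?divr_gt0 // [leLHS]mulrC; exact: H.
Qed.

(** * Euler-Lagrange equation *)

(* Both sides agree at [t = 0], so their derivatives there agree. *)
Lemma linear_coeff_eq (c lam a b d : R) : 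
  (forall t, c * lam ^+ 2 + 4 * t * d <= c * (lam + 2 * t * a + t ^+ 2 * b) ^+ 2) ->
  d = c * lam * a.
Proof.
(* [E] is the first-order discrepancy, and [K] bounds all terms of order two and higher, divided by
   t^2, for |t| <= 1. *)
move=> H; pose E := c * lam * a - d; pose K := `|c| * (4 * a ^+ 2 + 2 * `|lam * b| + 4 * `|a * b| + b ^+ 2).
have K0 : 0 <= K.
  rewrite /K; have := normr_ge0 c; have := normr_ge0 (lam * b); have := normr_ge0 (a * b).
  by have := sqr_ge0 a; have := sqr_ge0 b => *; rewrite mulr_ge0 //; lra.
have key t : `|t| <= 1 -> 0 <= 4 * t * E + K * t ^+ 2.
  move=> t1; have := H t.
  have h : c * (4 * a ^+ 2 + 2 * (lam * b) + 4 * (t * (a * b)) + t ^+ 2 * b ^+ 2) <= K.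
    apply: le_trans (ler_norm _) _; rewrite normrM ler_wpM2l //.
    have h1 : `|t * (a * b)| <= `|a * b| by rewrite normrM ler_piMl.
    have h2 : t ^+ 2 * b ^+ 2 <= b ^+ 2.
      by rewrite ler_piMl ?sqr_ge0 // -real_normK ?num_real // exprn_ile1.
    have := sqr_ge0 a; have := sqr_ge0 t; have := sqr_ge0 b => b2 t2 a2.
    have h3 := mulr_ge0 t2 b2.
    rewrite ler_norml; have := ler_norm (lam * b); have := ler_norm (- (lam * b)).
    move: h1; rewrite normrN ler_norml => /andP[? ?] ? ?.
    by apply/andP; split; lra.
  have := ler_wpM2r (sqr_ge0 t) h; rewrite /E.
  set X := c * _ * t ^+ 2 => h1 h2; rewrite -subr_ge0 in h2.
  have : c * (lam + 2 * t * a + t ^+ 2 * b) ^+ 2 - (c * lam ^+ 2 + 4 * t * d) =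
    4 * t * (c * lam * a - d) + X by rewrite /X; ring.
  by move=> e; rewrite e in h2; lra.
apply/eqP; rewrite eq_sym -subr_eq0 -/E; apply/negPn/negP => E0.
(* Test with t = - E/s: this size of [s] ensures both |t| <= 1 and 4 s > K, so the expression in
   [key] would be negative. *)
pose s := K + `|E| + 1.
have s0 : 0 < s by rewrite ltr_wpDl // addr_ge0.
have := key (- (E / s)); rewrite normrN normrM normfV (gtr0_norm s0).
rewrite ler_pdivrMr // mul1r => /(_ _).
have -> : 4 * (- (E / s)) * E + K * (- (E / s)) ^+ 2 = - ((E / s) ^+ 2 * (4 * s - K)).
  by field; rewrite gt_eqF.
rewrite oppr_ge0 => /(_ _) h.
have : 0 < (E / s) ^+ 2 * (4 * s - K).
  rewrite mulr_gt0 //; last by have := normr_ge0 E; rewrite /s; lra.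
  by rewrite exprn_even_gt0 //= mulf_neq0 // invr_eq0 gt_eqF.
rewrite ltNge h //; rewrite /s; lra.
Qed.

Lemma euler_lagrange_re (lam p : R) f g A B : 0 < lam ->
  (forall (h : int -> C) A, bnd (@sqc R \o h) A -> nrm h = lam -> qform h <= p) ->
  bnd (@sqc R \o f) A -> nrm f = lam -> qform f = p -> bnd (@sqc R \o g) B ->
  limn (win (qdiff g f)) = p / lam * rip g f.
Proof.
move=> lam0 hp fA fl fp gB.
have -> : p / lam * rip g f = p / lam ^+ 2 * lam * rip g f by field; rewrite gt_eqF.
(* The polynomial there is the squared norm of f + t g, namely lam + 2 t [rip g f] + t^2 [nrm g]. *)
apply: (@linear_coeff_eq _ _ _ (nrm g)) => t.
have tB := bndZ t%:C gB; have D := bndD fA tB.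
have -> : p / lam ^+ 2 * lam ^+ 2 = p by field; rewrite gt_eqF.
rewrite -{1}fp; apply: le_trans (qform_convex fA gB D) _.
apply: le_trans (qform_le_nrm lam0 hp D) _.
rewrite (nrmD fA tB) fl (ripZl t fA gB) (nrmZ t%:C gB).
rewrite [sqc _]/sqc /= expr0n addr0 mulrA; exact: lexx.
Qed.

Lemma euler_lagrange (lam p : R) f g A B : 0 < lam ->
  (forall (h : int -> C) A, bnd (@sqc R \o h) A -> nrm h = lam -> qform h <= p) ->
  bnd (@sqc R \o f) A -> nrm f = lam -> qform f = p -> bnd (@sqc R \o g) B ->
  (p / lam)%:C * inner g f = Qd mu g f f f.
Proof.
move=> lam0 hp fA fl fp gB; rewrite (inner_eq fA gB) (Qd_eq fA gB).
have e1 := euler_lagrange_re lam0 hp fA fl fp gB.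
have e2 := euler_lagrange_re lam0 hp fA fl fp (bndZ 'i gB).
apply: eqC; first by rewrite Re_realM; exact: esym e1.
by rewrite Im_realM; exact: esym e2.
Qed.

(** * Asymptotic splitting *)

(* Young's inequality is used with parameter [d] on a large window, where [b n] is
   small, and with [d^-1] outside of it, where the tail of [a] is small. *)
Lemma cross_vanish (T : Type) (F : set_system T) {FF : ProperFilter F}
  (a : int -> R) (b c : T -> int -> R) (A B K : R) :
  (forall x, 0 <= a x) -> bnd a A ->
  (forall n x, 0 <= b n x) -> (forall n, bnd (b n) B) ->
  (forall x, b n x @[n --> F] --> 0) -> 0 <= K ->
  (forall n x d, 0 < d -> `|c n x| <= K * (d * a x + d^-1 * b n x)) ->
  forall e, 0 < e -> \forall n \near F, forall N, `|win (c n) N| <= e.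
Proof.
move=> a0 aA b0 bB bc K0 hc e e0.
have A0 : 0 <= A := bnd_ge0 a0 aA.
have B0 : 0 <= B.
  by have [n _] := @filter_ex _ F _ _ filterT; exact: bnd_ge0 (b0 n) (bB n).
(* The choices of [d] and [e1] make each of the four error terms at most e/(4(K+1)); the added 1s
   keep the denominators positive. *)
pose d := e / (4 * (K + 1) * (A + B + 1)).
have d0 : 0 < d by rewrite divr_gt0 // mulr_gt0 // ?mulr_gt0 //; lra.
pose e1 := d * (e / (4 * (K + 1))).
have q0 : 0 < e / (4 * (K + 1)) by rewrite divr_gt0 // mulr_gt0 //; lra.
have e10 : 0 < e1 by rewrite mulr_gt0.
have [L hL] := win_tail a0 aA e10.
have bL : win (b n) L @[n --> F] --> win (fun=> 0) L by exact: cvg_win.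
have w0 : win (fun=> 0 : R) L = 0 by rewrite /win big1.
rewrite w0 in bL.
move/cvgrPdist_le : bL => /(_ _ e10); apply: filterS => n.
rewrite sub0r normrN => bn N.
apply: le_trans (ler_norm_win _ _) _.
apply: le_trans (nondecreasing_win (fun x => normr_ge0 (c n x)) (leq_maxl N L)) _.
set N' := maxn N L; have LN : (L <= N')%N by exact: leq_maxr.
have h1 : win (fun x => `|c n x|) L <= K * (d * win a L + d^-1 * win (b n) L).
  apply: le_trans (ler_win L (fun x => hc n x d d0)) _.
  by rewrite (winZ K) (winD (fun x => d * a x)) !winZ.
have di0 : 0 < d^-1 by rewrite invr_gt0.
have h2 : win (fun x => `|c n x|) N' - win (fun x => `|c n x|) L <=
    K * (d^-1 * (win a N' - win a L) + d * (win (b n) N' - win (b n) L)).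
  apply: le_trans (ler_win_diff (fun x => hc n x d^-1 di0) LN) _.
  rewrite !(winZ K) !(winD (fun x => d^-1 * a x)) !winZ invrK.
  by rewrite -mulrBr le_eqVlt; apply/orP; left; apply/eqP; congr (_ * _); ring.
have h3 := hL _ LN; have h4 := aA L; have h5 := bB n N'.
have h6 := win_ge0 L (b0 n); have h7 := le_trans (ler_norm _) bn.
have k1 : d * (A + B) <= e / (4 * (K + 1)).
  have -> : e / (4 * (K + 1)) = d * (A + B + 1).
    by rewrite /d; field; apply/andP; split; apply: lt0r_neq0; lra.
  by rewrite ler_pM2l //; lra.
have k2 : d^-1 * e1 = e / (4 * (K + 1)) by rewrite /e1 mulKf // gt_eqF.
have i1 := ler_wpM2l (ltW d0) h4; have i2 := ler_wpM2l (ltW d0) h5.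
have i3 := ler_wpM2l (ltW di0) h3; have i4 := ler_wpM2l (ltW di0) h7.
have i5 := mulr_ge0 (ltW d0) h6.
have : win (fun x => `|c n x|) N' <= K * (4 * (e / (4 * (K + 1)))).
  have : win (fun x => `|c n x|) N' <= K * (d * win a L + d^-1 * win (b n) L) +
     K * (d^-1 * (win a N' - win a L) + d * (win (b n) N' - win (b n) L)) by lra.
  move=> h; apply: le_trans h _; rewrite -mulrDr ler_wpM2l //; lra.
move=> h; apply: le_trans h _.
have -> : K * (4 * (e / (4 * (K + 1)))) = e * (K / (K + 1)).
  by field; apply: lt0r_neq0; lra.
by rewrite ler_piMr ?(ltW e0) // ler_pdivrMr; lra.
Qed.

(** Cauchy-Schwarz in the plane: the defect is the square of the imaginary part of conj(z) w. *)
Lemma rdot_sqr (z w : C) : rdot z w ^+ 2 <= sqc z * sqc w.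
Proof.
rewrite /rdot /sqc -subr_ge0.
apply: le_trans (sqr_ge0 (Re z * Im w - Im z * Re w)) _.
by rewrite le_eqVlt; apply/orP; left; apply/eqP; ring.
Qed.

Lemma rdot_young (z w : C) d : 0 < d -> 2 * `|rdot z w| <= d * sqc z + d^-1 * sqc w.
Proof.
move=> d0; rewrite /rdot /sqc; move: (Re z) (Im z) (Re w) (Im w) => a b a' b'.
have key (x y : R) : 0 <= d * x ^+ 2 + 2 * (x * y) + d^-1 * y ^+ 2.
  have -> : d * x ^+ 2 + 2 * (x * y) + d^-1 * y ^+ 2 = d^-1 * (d * x + y) ^+ 2.
    by field; rewrite gt_eqF.
  by rewrite mulr_ge0 ?sqr_ge0 // invr_ge0 ltW.
have := key a a'; have := key b b'; have := key (- a) a'; have := key (- b) b'.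
rewrite !sqrrN; case: (ler0P (a * a' + b * b')); lra.
Qed.

(** For u = |z|^2, v = |z'|^2 and w = Re(conj(z) z'), the expression on the left is |z + z'|^4 -
    |z|^4 - |z'|^4. The first two summands are at most 6 u v and the third contributes the factor 2,
    whence 8. *)
Lemma cross_bound (u v w S d : R) : 0 <= u -> 0 <= v -> u + v <= S -> 0 < d ->
  w ^+ 2 <= u * v -> 2 * `|w| <= d * u + d^-1 * v ->
  `|4 * w ^+ 2 + 2 * (u * v) + 4 * w * (u + v)| <= 8 * S * (d * u + d^-1 * v).
Proof.
move=> u0 v0 uvS d0 wuv wy.
have S0 : 0 <= S by lra.
have di0 : 0 < d^-1 by rewrite invr_gt0.
have du := mulr_ge0 (ltW d0) u0; have dv := mulr_ge0 (ltW di0) v0.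
have h1 : u * v <= S * (d * u + d^-1 * v).
  (* One of [d] and [d^-1] is at least 1; keep the factor it multiplies and bound the other one by
     [S]. *)
  have [d1|d1] := leP 1 d.
    rewrite mulrC; apply: ler_pM => //; first lra.
    by have := ler_wpM2r u0 d1; lra.
  apply: ler_pM => //; first lra.
  have : 1 <= d^-1 by rewrite invf_ge1 // ltW.
  by move=> h; have := ler_wpM2r v0 h; lra.
have h2 : 4 * `|w| * (u + v) <= 2 * S * (d * u + d^-1 * v).
  have -> : 4 * `|w| * (u + v) = 2 * ((u + v) * (2 * `|w|)) by ring.
  rewrite -mulrA ler_wpM2l //; have w0 := normr_ge0 w.
  by apply: ler_pM => //; lra.
apply: le_trans (ler_normD _ _) _.
rewrite (@ger0_norm _ (4 * w ^+ 2 + _)); last first.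
  by rewrite addr_ge0 // mulr_ge0 ?sqr_ge0 ?mulr_ge0.
have -> : `|4 * w * (u + v)| = 4 * `|w| * (u + v).
  by rewrite !normrM (ger0_norm (addr_ge0 u0 v0)) (ger0_norm (_ : 0 <= 4)).
lra.
Qed.

(** * Bounded families tending pointwise to zero *)

Section Vanishing.
Variables (T : Type) (F : set_system T).
Context {FF : ProperFilter F}.
Variables (g : T -> int -> C) (B : R).
Hypothesis gB : forall n, bnd (@sqc R \o g n) B.
Hypothesis g0 : forall x, ccvg F (g^~ x) 0.

Lemma sqc0 : sqc (0 : C) = 0.
Proof. by rewrite /sqc /= expr0n addr0. Qed.

Lemma normc_vanish (u : T -> C) : ccvg F u 0 -> normc (u n) @[n --> F] --> 0.
Proof.
move=> u0; apply/cvgrPdist_le => e e0.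
have := @ccvg_sqc R T F FF u 0 u0; rewrite sqc0 => /cvgrPdist_le /(_ (e ^+ 2)).
rewrite exprn_gt0 // => /(_ isT); apply: filterS => n.
rewrite !sub0r !normrN => h.
by rewrite ger0_norm ?normc_ge0 //; apply: normc_le (ltW e0) (le_trans (ler_norm _) h).
Qed.

Lemma cvg_sum0 N (u : nat -> T -> R) : (forall k : nat, u k n @[n --> F] --> 0) ->
  (fun n => \sum_(k < N) u k n) @ F --> 0.
Proof.
move=> u0; elim: N => [|N IH].
  have -> : (fun n => \sum_(k < 0) u k n) = (fun=> 0).
    by apply/funext => n; rewrite big_ord0.
  exact: cvg_cst.
have -> : (fun n => \sum_(k < N.+1) u k n) = (fun n => \sum_(k < N) u k n + u N n).
  by apply/funext => n; rewrite big_ord_recr.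
by have := cvgD IH (u0 N); rewrite addr0; apply.
Qed.

Lemma iter_dlap_vanish (k : nat) x : ccvg F (fun n => iter k (@dlap R) (g n) x) 0.
Proof.
elim: k x => [|k IH] x; first exact: g0.
have -> : 0 = 0 + 0 - 2%:R * 0 :> C by rewrite mulr0 subr0 addr0.
apply: ccvgD; first by apply: ccvgD; exact: IH.
by apply: ccvgN; apply: ccvgM; [exact: ccvg_cst|exact: IH].
Qed.

(** The series is truncated with an error uniform in [n] and in [|r| <= M]; the remaining finitely
    many terms involve only finitely many sites near [x]. *)
Lemma Sr_vanish M x e : 0 <= M -> 0 < e ->
  \forall n \near F, forall r, `|r| <= M -> normc (Sr r (g n) x) <= e.
Proof.
move=> M0 e0; have e20 : 0 < e / 2 by lra.
have gn n : forall y, normc (g n y) <= Num.sqrt B := bnd_normc (gB n).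
have : (fun N => Num.sqrt B * etail (4 * M) N) @ \oo --> 0.
  rewrite -[X in _ --> X](mulr0 (Num.sqrt B)).
  by apply: cvgMl_tmp; exact: cvg_etail.
move=> /cvgrPdist_le /(_ _ e20) [N _ /(_ N (leqnn N))].
rewrite /= sub0r normrN => hN.
pose h n := \sum_(k < N) M ^+ k / (k`!)%:R * normc (iter k (@dlap R) (g n) x).
have hu (k : nat) : M ^+ k / (k`!)%:R * normc (iter k (@dlap R) (g n) x) @[n --> F] --> 0.
  have := normc_vanish (iter_dlap_vanish k x).
  by move=> /(cvgMl_tmp (a := M ^+ k / (k`!)%:R)); rewrite mulr0.
have := cvg_sum0 N hu.
move=> /cvgrPdist_le /(_ _ e20); apply: filterS => n; rewrite sub0r normrN => hn r rM.
have -> : Sr r (g n) x = (Sr r (g n) x - SrN r (g n) x N) + SrN r (g n) x N by rewrite subrK.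
apply: le_trans (ler_normcD _ _) _.
have h1 := Sr_tail x N (gn n) rM.
have h2 : normc (SrN r (g n) x N) <= h n.
  apply: le_trans (ler_normc_sum _ _) _; apply: ler_sum => k _.
  rewrite !ComplexField.Normc.normcM ComplexField.Normc.normcV.
  rewrite normc_nat normcX ComplexField.Normc.normcM normc_i mul1r normc_real.
  rewrite ler_wpM2r ?normc_ge0 // ler_wpM2r ?invr_ge0 //.
  by rewrite lerXn2r ?nnegrE.
have := ler_norm (h n); have := ler_norm (Num.sqrt B * etail (4 * M) N); lra.
Qed.

Variable M : R.
Hypothesis M_ge0 : 0 <= M.
Hypothesis mu_supp : mu [set r | M < `|r|] = 0%E.

Lemma mass2_vanish x : mass2 (g n) x @[n --> F] --> 0.
Proof.
apply/cvgrPdist_le => e e0; have m0 := mass_ge0.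
(* Then d^2 times the total mass of [mu] is at most [e]. *)
pose d := Num.sqrt (e / (m + 1)).
have q0 : 0 < e / (m + 1) by rewrite divr_gt0 //; lra.
have d0 : 0 < d by rewrite sqrtr_gt0.
apply: filterS (Sr_vanish x M_ge0 d0) => n hn.
rewrite sub0r normrN ger0_norm ?mass2_ge0 //.
apply: le_trans (_ : I (fun=> e / (m + 1)) <= _).
  apply: (ler_integral_supp mu_supp) => [||r rM].
  - exact: bmeas_sqc_Sr (gB n).
  - exact: bmeas_cst.
  - rewrite -sqr_normc -(sqr_sqrtr (ltW q0)) lerXn2r ?nnegrE ?normc_ge0 ?sqrtr_ge0 //.
    exact: hn.
rewrite integral_cst mulrAC ler_pdivrMr; last lra.
by rewrite ler_wpM2l ?(ltW e0) //; lra.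
Qed.

(** The cross terms [cr] are controlled by the densities [mass2 f] and [mass2 (g n)] through
    [cross_bound], so [cross_vanish] makes their sum small uniformly in the window. *)
Lemma qform_split f A e : bnd (@sqc R \o f) A -> 0 < e ->
  \forall n \near F, qform (fun x => f x + g n x) <= qform f + qform (g n) + e.
Proof.
move=> fA e0.
pose cr n x := I (fun r => 4 * rdot (Sr r f x) (Sr r (g n) x) ^+ 2 +
   2 * (sqc (Sr r f x) * sqc (Sr r (g n) x)) +
   4 * rdot (Sr r f x) (Sr r (g n) x) * (sqc (Sr r f x) + sqc (Sr r (g n) x))).
have A0 : 0 <= A := bnd_ge0 (sqc_comp_ge0 f) fA.
have bm n x : bmeas (fun r => 4 * rdot (Sr r f x) (Sr r (g n) x) ^+ 2 +
   2 * (sqc (Sr r f x) * sqc (Sr r (g n) x)) +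
   4 * rdot (Sr r f x) (Sr r (g n) x) * (sqc (Sr r f x) + sqc (Sr r (g n) x))).
  have b1 := bmeas_sqc_Sr x fA; have b2 := bmeas_sqc_Sr x (gB n).
  have b3 := bmeas_rdot_Sr x (gB n) fA.
  apply: bmeasD; first apply: bmeasD.
  - by apply: bmeasZ; exact: bmeasX.
  - by apply: bmeasZ; exact: bmeasM.
  - by apply: bmeasM; [exact: bmeasZ | exact: bmeasD].
have B0 : 0 <= B.
  by have [n _] := @filter_ex _ F _ _ filterT; exact: bnd_ge0 (sqc_comp_ge0 (g n)) (gB n).
have K0 : 0 <= 8 * (A + B) by lra.
have hcr n x d : 0 < d ->
    `|cr n x| <= 8 * (A + B) * (d * mass2 f x + d^-1 * mass2 (g n) x).
  move=> d0; have b1 := bmeas_sqc_Sr x fA; have b2 := bmeas_sqc_Sr x (gB n).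
  have z1 := bmeasZ d b1; have z2 := bmeasZ d^-1 b2.
  rewrite /mass2 -(integral_Z d b1) -(integral_Z d^-1 b2) -(integral_D z1 z2).
  rewrite -(integral_Z (8 * (A + B)) (bmeasD z1 z2)).
  apply: ler_norm_integral => // [|r]; first by apply: bmeasZ; exact: bmeasD.
  apply: cross_bound; rewrite ?sqc_ge0 //.
  - apply: lerD.
      exact: (bnd_term (a := @sqc R \o Sr r f) x (sqc_comp_ge0 _) (bnd_Sr r fA)).
    exact: (bnd_term (a := @sqc R \o Sr r (g n)) x (sqc_comp_ge0 _) (bnd_Sr r (gB n))).
  - exact: rdot_sqr.
  - exact: rdot_young.
have := cross_vanish (FF := FF) (mass2_ge0 f) (bnd_mass2 fA) (fun n => mass2_ge0 (g n))
  (fun n => bnd_mass2 (gB n)) mass2_vanish K0 hcr e0.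
apply: filterS => n hn; have gf := bndD fA (gB n).
apply: (@sm_le R (quartic (fun x => f x + g n x)) _ (quartic_ge0 _)) => N.
have E x : quartic (fun x => f x + g n x) x = (quartic f x + quartic (g n) x) + cr n x.
  have b1 := bmeas_sqc_Sr x fA; have b2 := bmeas_sqc_Sr x (gB n).
  have z1 := bmeasX 2 b1; have z2 := bmeasX 2 b2.
  apply: etrans (_ : I _ + I _ + I _ = _); last by [].
  rewrite -(integral_D z1 z2) -(integral_D (bmeasD z1 z2) (bm n x)).
  apply: (congr1 I); apply/funext => r.
  rewrite (SrD _ _ (bnd_normc fA) (bnd_normc (gB n))) /sqc /rdot !reimE; ring.
rewrite (eq_win _ E) (winD (fun x => quartic f x + quartic (g n) x)) (winD (quartic f)).
apply: lerD; last exact: le_trans (ler_norm _) (hn N).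
apply: lerD; first exact: win_le_sm (quartic_ge0 f) (bnd_quartic fA).
exact: win_le_sm (quartic_ge0 (g n)) (bnd_quartic (gB n)).
Qed.

(** Expand the square by [nrmD]; the inner product term tends to 0 by [cross_vanish] with [K] equal
    to 1. *)
Lemma nrm_split f A e : bnd (@sqc R \o f) A -> 0 < e ->
  \forall n \near F, nrm (g n) <= nrm (fun x => f x + g n x) - nrm f + e.
Proof.
move=> fA e0; have e20 : 0 < e / 2 by lra.
have hc n x d : 0 < d ->
    `|rdot (g n x) (f x)| <= 1 * (d * (@sqc R \o f) x + d^-1 * (@sqc R \o g n) x).
  move=> d0; have := rdot_young (f x) (g n x) d0.
  have -> : rdot (g n x) (f x) = rdot (f x) (g n x) by rewrite /rdot; ring.
  by have := normr_ge0 (rdot (f x) (g n x)); rewrite /=; lra.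
have s0 x : (@sqc R \o g n) x @[n --> F] --> 0.
  by have := @ccvg_sqc R T F FF _ _ (g0 x); rewrite sqc0.
have := cross_vanish (FF := FF) (sqc_comp_ge0 f) fA (fun n => sqc_comp_ge0 (g n)) gB s0 ler01 hc e20.
apply: filterS => n hn; rewrite (nrmD fA (gB n)).
have : - (e / 2) <= rip (g n) f.
  apply: limr_ge; first exact: cvg_rip fA (gB n).
  by apply: nearW => N; have := hn N; rewrite ler_norml => /andP[].
lra.
Qed.
End Vanishing.
(** * Existence of maximizers *)

Lemma bnd_supp (a : int -> R) L : (forall x, 0 <= a x) ->
  (forall x, (L < `|x|)%N -> a x = 0) -> bnd a (win a L).
Proof.
move=> a0 aL N; have [NL|/ltnW LN] := leqP N L; first exact: nondecreasing_win.
elim: N LN => [|N IH]; first by rewrite leqn0 => /eqP ->.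
rewrite leq_eqVlt => /orP[/eqP -> //|]; rewrite ltnS => LN.
by rewrite winS !aL ?addr0 ?IH //; lia.
Qed.

Definition box (L : nat) (x : int) : C := (`|x| <= L)%N%:R.

Lemma sqc_nat (n : nat) : sqc (n%:R : C) = n%:R ^+ 2.
Proof. by rewrite /sqc Re_nat Im_nat expr0n addr0. Qed.

Lemma bnd_box L : bnd (@sqc R \o box L) (win (@sqc R \o box L) L).
Proof.
by apply: bnd_supp => // x xL; rewrite /= /box leqNgt xL sqc_nat expr0n.
Qed.

Lemma normc_box L x : normc (box L x) <= 1.
Proof. by rewrite /box normc_nat; case: (_ <= _)%N; rewrite ?lexx ?ler01. Qed.

(** The k-th iterate at [x] sees only sites within distance [k], where [box L] is constant and hence
    annihilated by the Laplacian. *)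
Lemma iter_dlap_box (L k : nat) (x : int) : (`|x| + k <= L)%N ->
  iter k (@dlap R) (box L) x = (k == 0)%N%:R.
Proof.
elim: k x => [|k IH] x xk; first by rewrite /= /box (_ : (_ <= _)%N = true) //; lia.
rewrite iterS /dlap !IH; [|lia..].
by case: k {IH xk} => [|k] /=; ring.
Qed.

Variable M : R.
Hypothesis M_ge0 : 0 <= M.
Hypothesis mu_supp : mu [set r | M < `|r|] = 0%E.
Hypothesis m_gt0 : 0 < m.

(* On a box much larger than the time horizon [M] the Laplacian does not see the
   boundary from the origin, so [Sr r f 0] stays close to [f 0 = 1]. *)
Lemma qform_box_gt0 : exists L, 0 < nrm (box L) /\ 0 < qform (box L).
Proof.
have h2 : 0 < 1 / 2 :> R by lra.
have := cvg_etail (4 * M).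
(* [L] makes the tail after L+1 terms at most 1/2, so that |S_r f| >= 1/2 at the origin; its fourth
   power accounts for 1/16. *)
move=> /cvgrPdist_le /(_ _ h2) [L _ /(_ L.+1 (leqnSn L))].
rewrite /= sub0r normrN => hL; exists L; have bL := bnd_box L.
have f0 : box L 0 = 1 by rewrite /box.
split.
  apply: lt_le_trans (_ : 0 < sqc (box L 0)) _; first by rewrite f0 (sqc_nat 1) expr1n.
  by apply: (bnd_term (a := @sqc R \o box L)) => //; exact: bnd_nrm bL.
apply: lt_le_trans (_ : 0 < m / 16) _; first by rewrite divr_gt0.
apply: le_trans (_ : quartic (box L) 0 <= _); last first.
  by have := win_le_sm 0 (quartic_ge0 (box L)) (bnd_quartic bL); rewrite win0.
have -> : m / 16 = I (fun=> 1 / 16) by rewrite integral_cst; ring.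
apply: (ler_integral_supp mu_supp) => [||r rM].
- exact: bmeas_cst.
- by apply: bmeasX; exact: bmeas_sqc_Sr bL.
(* These L+1 terms use at most L iterates of the Laplacian, so at the origin only the zeroth term
   survives. *)
have S1 : SrN r (box L) 0 L.+1 = 1.
  rewrite /SrN big_ord_recl /= f0 expr0 invr1 !mulr1 big1 ?addr0 // => k _.
  by rewrite -iterS iter_dlap_box /bump /= ?mulr0 //; have := ltn_ord k; lia.
have := Sr_tail 0 L.+1 (normc_box L) rM; rewrite S1 mul1r => h.
have : 1 / 2 <= normc (Sr r (box L) 0).
  have := ler_normcD (Sr r (box L) 0) (- (Sr r (box L) 0 - 1)).
  rewrite normc_opp opprB addrC subrK ComplexField.Normc.normc1.
  by have := ler_norm (etail (4 * M) L.+1); lra.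
move=> h1; rewrite -sqr_normc -exprM.
have -> : 1 / 16 = (1 / 2) ^+ (2 * 2) :> R by field.
by rewrite lerXn2r ?nnegrE ?normc_ge0 // ltW.
Qed.

(** A rescaled box; it makes the supremum positive, which is used both for compactness and for omega
    > 0. *)
Lemma qform_feasible_gt0 (lam : R) : 0 < lam ->
  exists f A, [/\ bnd (@sqc R \o f) A, nrm f = lam & 0 < qform f].
Proof.
move=> lam0; have [L [n0 q0]] := qform_box_gt0.
have bL := bnd_box L.
pose s := Num.sqrt (lam / nrm (box L)).
have s0 : 0 < lam / nrm (box L) by rewrite divr_gt0.
have ss : sqc s%:C = lam / nrm (box L).
  by rewrite /sqc /= expr0n addr0 sqr_sqrtr // ltW.
exists (fun x => s%:C * box L x), (sqc s%:C * win (@sqc R \o box L) L); split.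
- exact: bndZ.
- by rewrite (nrmZ _ bL) ss divfK ?gt_eqF.
- by rewrite (qformZ _ bL) ss mulr_gt0 // exprn_gt0.
Qed.

(** The image of [U] is an ultrafilter containing a compact interval. One ultrafilter serves all
    sites at once, in place of a diagonal subsequence. *)
Lemma ultra_cvg_bounded (T : Type) (U : set_system T) {UF : UltraFilter U}
  (u : T -> R) (B : R) : (forall n, `|u n| <= B) -> exists l : R, u n @[n --> U] --> l.
Proof.
move=> uB; have UP : ProperFilter U by exact: (@ultra_proper _ _ UF).
have ultra_u : UltraFilter (u @ U).
  split; first exact: fmap_proper_filter.
  move=> G GP sub; apply/seteqP; split => [A GA|A]; last exact: sub.
  have [//|] := in_ultra_setVsetC (u @^-1` A) UF.
  move=> h; have GC : G (~` A) by apply: sub.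
  by have [y []] := @filter_ex _ G GP _ (filterI GA GC).
have := @segment_compact R (- B) B; rewrite compact_ultra => /(_ (u @ U) ultra_u).
case.
  by apply: (@filterS _ U _ setT) => [n _|]; [rewrite /= in_itv /= -ler_norml|exact: filterT].
by move=> l [_ ul]; exists l.
Qed.

Lemma ultra_ccvg_bounded (T : Type) (U : set_system T) {UF : UltraFilter U}
  (u : T -> C) (B : R) : (forall n, normc (u n) <= B) -> exists l : C, ccvg U u l.
Proof.
move=> uB.
have [a ha] := ultra_cvg_bounded (fun n => le_trans (Re_le_normc (u n)) (uB n)).
have [b hb] := ultra_cvg_bounded (fun n => le_trans (Im_le_normc (u n)) (uB n)).
by exists (a +i* b); split.
Qed.

Lemma sqr_perturb (a lam y e : R) : 0 <= a -> a <= lam -> 0 <= y ->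
  y <= lam - a + e -> 0 <= e -> e <= 1 ->
  y ^+ 2 <= (lam - a) ^+ 2 + (2 * lam + 1) * e.
Proof.
move=> a0 al y0 ye e0 e1.
apply: le_trans (_ : (lam - a + e) ^+ 2 <= _).
  by rewrite lerXn2r ?nnegrE //; apply: le_trans ye.
have ee : e ^+ 2 <= e by rewrite expr2 ler_piMr.
have ae : 0 <= a * e by rewrite mulr_ge0.
by rewrite !expr2 in ee *; lra.
Qed.

(** In its application [qF], [q] and [qg] are the values of [qform] at [F n], at the limit and at
    the remainder; [y] is the squared [nrm] of the remainder, and [ph] the defect of the maximizing
    sequence. *)
Lemma defect_bound (p ph q qg qF k y X Y e : R) :
  p - ph <= qF -> qF <= q + qg + e -> qg <= k * y -> k * y <= k * (X + Y * e) ->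
  ph <= p / 2 * e -> p <= q + k * X + (k * Y + 1 + p / 2) * e.
Proof.
rewrite mulrDr mulrA !mulrDl mul1r.
move: (k * y) (k * X) (k * Y * e) (p / 2 * e) => x1 x2 x3 x4; lra.
Qed.

Lemma maximizer_exists (lam p : R) : 0 < lam -> 0 < p ->
  (forall (h : int -> C) A, bnd (@sqc R \o h) A -> nrm h = lam -> qform h <= p) ->
  (forall e, 0 < e -> exists (h : int -> C) A,
     [/\ bnd (@sqc R \o h) A, nrm h = lam & p - e < qform h]) ->
  exists f A, [/\ bnd (@sqc R \o f) A, nrm f = lam & qform f = p].
Proof.
move=> lam0 p0 hp happ.
pose K := expR (4 * M) ^+ 2 * (lam * m).
have K0 : 0 < K by rewrite mulr_gt0 ?exprn_gt0 ?expR_gt0 ?mulr_gt0.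
(* By [qform_sup], a function of mass [lam] with |h|^2 <= c everywhere has [qform] at most c K =
   p/2. *)
pose c := p / 2 / K.
have c0 : 0 < c by rewrite !divr_gt0.
(* Mass cannot spread out: otherwise [f_n] would tend to [0] uniformly and so
   would [qform f_n]; hence after a translation [f_n 0] stays away from [0]. *)
have seq_ex n : exists f : int -> C, [/\ bnd (@sqc R \o f) lam, nrm f = lam,
    c <= sqc (f 0) & p - p / 2 * harmonic n <= qform f].
  have en0 : 0 < p / 2 * harmonic n by rewrite mulr_gt0 ?divr_gt0 ?invr_gt0 ?ltr0n.
  have [h [A [hA hl hq]]] := happ _ en0.
  have hlam : bnd (@sqc R \o h) lam by rewrite -hl; exact: bnd_nrm hA.
  have [x hx] : exists x, c < sqc (h x).
    apply/not_existsP => hx.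
    have := qform_sup mu_supp M_ge0 hlam (ltW c0) (fun x => _).
    have cK : c * expR (4 * M) ^+ 2 * (lam * m) = p / 2.
      by rewrite -mulrA -/K /c divfK // gt_eqF.
    rewrite cK => H.
    have : qform h <= p / 2.
      by apply: H => x; rewrite leNgt; apply/negP; exact: hx.
    have : p / 2 * harmonic n <= p / 2.
      have n1 : harmonic n <= 1 :> R by rewrite /harmonic /= invf_le1 ?ltr0n // ler1n.
      by apply: ler_piMr n1; lra.
    by move: hq; rewrite ltrBlDr; lra.
  exists (fun y => h (y + x)); split.
  - exact: (bnd_shift x (sqc_comp_ge0 h) hlam).
  - by rewrite (nrm_shift x hA).
  - by rewrite add0r ltW.
  - by rewrite (qform_shift x hA) ltW.
have [F hF] := choice seq_ex.
(* [U] refines [\oo], so properties that hold eventually, such as smallness of [harmonic n], hold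
   along [U]. *)
have [U [UF Uoo]] := @ultraFilterLemma nat (\oo : set_system nat) _.
have UP : ProperFilter U by exact: (@ultra_proper _ _ UF).
have FB n x : normc (F n x) <= Num.sqrt lam by have [h _ _ _] := hF n; exact: bnd_normc h x.
have [f hf] := choice (fun x => ultra_ccvg_bounded (fun n => FB n x)).
have flam : bnd (@sqc R \o f) lam.
  move=> N.
  have h : win (@sqc R \o F n) N @[n --> U] --> win (@sqc R \o f) N.
    by apply: cvg_win => x; exact: (@ccvg_sqc _ _ U).
  rewrite -(cvg_lim (@Rhausdorff _) h); apply: limr_le.
    by apply/cvg_ex; exists (win (@sqc R \o f) N).
  by apply: nearW => n; have [hb _ _ _] := hF n; exact: hb.
have f0 : c <= sqc (f 0).
  have h := @ccvg_sqc _ _ U UP _ _ (hf 0).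
  rewrite -(cvg_lim (@Rhausdorff _) h); apply: limr_ge.
    by apply/cvg_ex; exists (sqc (f 0)).
  by apply: nearW => n; have [_ _ hb _] := hF n; exact: hb.
pose a := nrm f.
have fa : bnd (@sqc R \o f) a := bnd_nrm flam.
have a0 : 0 < a.
  by apply: lt_le_trans c0 (le_trans f0 _); exact: (bnd_term (a := @sqc R \o f)).
have alam : a <= lam := sm_le (sqc_comp_ge0 f) flam.
pose g n x := F n x + (- 1) * f x.
have gB n : bnd (@sqc R \o g n) (2 * lam + 2 * (sqc (- 1 : C) * lam)).
  by apply: bndD; [have [hb _ _ _] := hF n|exact: bndZ].
have g0 x : ccvg U (g^~ x) 0.
  have -> : 0 = f x + (- 1) * f x by rewrite mulN1r subrr.
  by apply: ccvgD => //; apply: ccvgM; [exact: ccvg_cst|exact: ccvg_cst].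
have Fg n : F n = (fun x => f x + g n x).
  by apply/funext => x; rewrite /g mulN1r addrC subrK.
pose k := p / lam ^+ 2.
have k0 : 0 < k by rewrite divr_gt0 ?exprn_gt0.
have key e : 0 < e -> e <= 1 ->
    p <= qform f + k * (lam - a) ^+ 2 + (k * (2 * lam + 1) + 1 + p / 2) * e.
  move=> e0 e1.
  have h1 := qform_split (FF := UP) gB g0 M_ge0 mu_supp fa e0.
  have h2 := nrm_split (FF := UP) gB g0 fa e0.
  have h3 : \forall n \near U, harmonic n <= e.
    apply: Uoo; have /cvgrPdist_le /(_ e e0) := @cvg_harmonic R.
    by apply: filterS => n; rewrite sub0r normrN; apply: le_trans; exact: ler_norm.
  (* A single index at which both splittings hold up to [e] and [F n] is nearly maximizing. *)
  have [n [[q1 q2] q3]] := @filter_ex _ U _ _ (filterI (filterI h1 h2) h3).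
  have [_ hl _ hq] := hF n; move: q1 q2; rewrite -Fg hl -/a => q1 q2.
  have q4 := qform_le_nrm lam0 hp (gB n); rewrite -/k in q4.
  have q5 := nrm_ge0 (gB n).
  have q6 := sqr_perturb (ltW a0) alam q5 q2 (ltW e0) e1.
  have q7 := ler_wpM2l (ltW k0) q6.
  have q8 : p / 2 * harmonic n <= p / 2 * e by rewrite ler_wpM2l // divr_ge0 // ltW.
  exact: defect_bound hq q1 q4 q7 q8.
have main : p <= qform f + k * (lam - a) ^+ 2.
  apply/ler_addgt0Pr => e e0.
  pose D := k * (2 * lam + 1) + 1 + p / 2.
  have D0 : 0 < D by rewrite /D; have := mulr_gt0 k0 (_ : 0 < 2 * lam + 1); lra.
  (* The cap at 1 is the range allowed in [key]; the other bound gives D e' <= e. *)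
  pose e' := Num.min 1 (e / D).
  have e'0 : 0 < e' by rewrite lt_min ltr01 divr_gt0.
  apply: le_trans (key e' e'0 _) _; first by rewrite ge_min lexx.
  rewrite lerD2l -/D mulrC -ler_pdivlMr //.
  by rewrite ge_min lexx orbT.
have qa := qform_le_nrm lam0 hp fa; rewrite -/k -/a in qa.
have kp : k * lam ^+ 2 = p by rewrite /k divfK // gt_eqF // exprn_gt0.
(* [main] and [qa] give lam^2 <= a^2 + (lam - a)^2, that is a lam <= a^2; divide by a > 0. *)
have al : a = lam.
  apply/eqP; rewrite eq_le alam /= -(ler_pM2l a0) -(ler_pM2l k0).
  by rewrite -kp in main; lra.
exists f, a; split => //; apply/eqP; rewrite eq_le (hp _ _ fa) //=.
by move: main; rewrite al subrr expr0n mulr0 addr0.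
Qed.
End Integral.

(** * From the extended-real supremum to the real quartic form *)

Lemma feasibleP (R : realType) (f : int -> R[i]) (lam : R) :
  (is_l2 f /\ l2sqnorm f = lam%:E) <->
  (exists A, bnd (@sqc R \o f) A /\ nrm f = lam).
Proof.
split=> [[/is_l2P [A fA] fl]|[A [fA fl]]].
  by exists A; split => //; move: fl; rewrite (l2sqnorm_sm fA) => -[].
by split; [apply/is_l2P; exists A | rewrite (l2sqnorm_sm fA) -fl].
Qed.

Section Supremum.
Variables (R : realType) (mu : {measure set R -> \bar R}).
Hypothesis fin_mu : (mu [set: R] < +oo)%E.

Lemma Pd_le (lam : R) : (Pd mu lam <= (lam * (lam * mass mu))%:E)%E.
Proof.
apply: ge_ereal_sup => _ [f /feasibleP [A [fA fl]] <-].
rewrite (Qd_diag fin_mu fA) lee_fin /= -fl.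
exact: (qform_le fin_mu (bnd_nrm fA)).
Qed.

Lemma qform_le_Pd (lam p : R) (h : int -> R[i]) A : Pd mu lam = p%:E ->
  bnd (@sqc R \o h) A -> nrm h = lam -> qform mu h <= p.
Proof.
move=> Pp hA hl; rewrite -lee_fin -Pp.
apply: ereal_sup_ubound; exists h; first by apply/feasibleP; exists A.
by rewrite (Qd_diag fin_mu hA).
Qed.

Lemma Pd_approx (lam p : R) : Pd mu lam = p%:E -> forall e, 0 < e ->
  exists (h : int -> R[i]) A,
    [/\ bnd (@sqc R \o h) A, nrm h = lam & p - e < qform mu h].
Proof.
move=> Pp e e0.
have fP : Pd mu lam \is a fin_num by rewrite Pp.
have [_ [h /feasibleP [A [hA hl]] <-]] := ub_ereal_sup_adherent e0 fP.
rewrite -/(Pd mu lam) Pp (Qd_diag fin_mu hA) -EFinB lte_fin /= => hq.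
by exists h, A.
Qed.

End Supremum.

Unset Implicit Arguments.

Theorem theorem1p2 (R : realType) (mu : {measure set R -> \bar R}) :
  (mu [set: R] < +oo)%E ->
  mu [set: R] != 0%E ->
  (forall lam : R, 0 < lam -> (Pd mu lam < +oo)%E) /\
  ((exists M : R, mu [set r : R | M < `|r|] = 0%E) ->
   forall lam : R, 0 < lam ->
     (exists (f : int -> R[i]) (p : R), is_l2 f /\ l2sqnorm f = lam%:E /\
        Pd mu lam = p%:E /\ Qd mu f f f f = p%:C) /\
     (forall (f : int -> R[i]) (p : R),
        is_l2 f -> l2sqnorm f = lam%:E ->
        Pd mu lam = p%:E -> Qd mu f f f f = p%:C ->
        0 < p / lam /\
        (forall g : int -> R[i], is_l2 g ->
           (p / lam)%:C * inner g f = Qd mu g f f f))).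
Proof.
move=> fin_mu mu_neq0.
have m0 : 0 < mass mu by apply: fine_gt0; rewrite fin_mu lt0e mu_neq0 measure_ge0.
split=> [lam lam0|[M hM] lam lam0].
  exact: le_lt_trans (Pd_le fin_mu lam) (ltry _).
(* For negative [M] the null set would be the whole line, although [mu] is nonzero. *)
have M0 : 0 <= M.
  rewrite leNgt; apply/negP => Mlt; move/eqP: mu_neq0; apply.
  rewrite -hM; congr (mu _); apply/seteqP; split => // r _ /=.
  exact: lt_le_trans Mlt (normr_ge0 r).
(* This competitor keeps the supremum away from [-oo] and makes it positive. *)
have [f0 [A0 [f0A f0l q0]]] := qform_feasible_gt0 fin_mu M0 hM m0 lam0.
have lbP : ((qform mu f0)%:E <= Pd mu lam)%E.
  apply: ereal_sup_ubound; exists f0; first by apply/feasibleP; exists A0.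
  by rewrite (Qd_diag fin_mu f0A).
have finP : Pd mu lam \is a fin_num.
  rewrite fin_numE -ltNye -ltey; apply/andP; split.
    exact: lt_le_trans (ltNyr _) lbP.
  exact: le_lt_trans (Pd_le fin_mu lam) (ltry _).
pose p := fine (Pd mu lam).
have Pp : Pd mu lam = p%:E by rewrite fineK.
have hp := fun h A => @qform_le_Pd R mu fin_mu lam p h A Pp.
have p0 : 0 < p by apply: lt_le_trans q0 _; exact: hp f0A f0l.
split.
  have [f [A [fA fl fq]]] :=
    maximizer_exists fin_mu M0 hM m0 lam0 p0 hp (Pd_approx fin_mu Pp).
  have [fl2 fn] : is_l2 f /\ l2sqnorm f = lam%:E by apply/feasibleP; exists A.
  by exists f, p; rewrite (Qd_diag fin_mu fA) fq.
move=> f p' fl2 fn; rewrite Pp => -[<-] fQ.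
have [A [fA fl]] : exists A, bnd (@sqc R \o f) A /\ nrm f = lam by apply/feasibleP.
split; first exact: divr_gt0.
move=> g /is_l2P [B gB].
apply: (euler_lagrange fin_mu lam0 hp fA fl _ gB).
by apply: complexI; rewrite -(Qd_diag fin_mu fA).
Qed.
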